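(* Let $(X,\mathfrak M,\mu)$ be a measure space, let $N\ge1$, and let $\mathcal S_1,\dots,\mathcal S_N\subset\mathfrak M$ be finite-martingale sparse collections of measurable sets. Put $\mathcal S=\bigcup_{k=1}^N\mathcal S_k$, $\mathfrak G=\{\mathcal S_1,\dots,\mathcal S_N\}$, and $$\Lambda_{\mathfrak G}f(x)=\max_{1\le k\le N}\Lambda_{\mathcal S_k}f(x).$$ Then $$\|\Lambda_{\mathfrak G}\|_{L^p\to L^{p,\infty}}\lesssim\log_+N\cdot\|\mathcal M_{\mathcal S}\|_{L^p\to L^{p,\infty}},\qquad 1\le p<\infty,$$ $$\|\Lambda_{\mathfrak G}\|_{L^p\to L^{p}}\lesssim(\log_+N)^{\max\{1,1/(p-1)\}}\cdot\|\mathcal M_{\mathcal S}\|_{L^p\to L^{p}},\qquad 1<p<\infty.$$ Here the implicit constants depend only on $p$ and on the constants in the definitions of sparse and finite-martingale collections (a common sparsity constant $\gamma$, and common finite-martingale constants $d$ and $C$, for all $\mathcal S_k$).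
   Context: $\log_+n=\max\{1,\log_2n\}$. For a measurable set $B$ (members of the collections are taken to have positive finite measure, so that averages make sense), $\langle f\rangle_B=\mu(B)^{-1}\int_B|f|\,d\mu$. For a collection $\mathfrak B\subset\mathfrak M$, the maximal function is $\mathcal M_{\mathfrak B}f(x)=\sup_{B\in\mathfrak B}\langle f\rangle_B\mathbf 1_B(x)$. A collection $\mathcal S\subset\mathfrak M$ is sparse if there is a constant $0<\gamma<1$ such that each $S\in\mathcal S$ has a measurable subset $E_S\subset S$ with $\mu(E_S)\ge\gamma\mu(S)$, the sets $E_S$, $S\in\mathcal S$, being pairwise disjoint. The corresponding sparse operator is $\Lambda_{\mathcal S}f(x)=\sum_{S\in\mathcal S}\langle f\rangle_S\mathbf 1_S(x)$. A family $\mathfrak B\subset\mathfrak M$ is a martingale collection if for any $A,B\in\mathfrak B$ one has $A\subset B$, $B\subset A$ or $A\cap B=\varnothing$. A family $\mathfrak B\subset\mathfrak M$ is a finite-martingale collection if there are finitely many martingale collections $\mathfrak B_1,\dots,\mathfrak B_d\subset\mathfrak M$ and a constant $C$ such that for every $B\in\mathfrak B$ there is $B'\in\bigcup_k\mathfrak B_k$ with $B\subset B'$ and $\mu(B')\le C\mu(B)$. A finite-martingale sparse collection is a collection that is both finite-martingale and sparse. $L^p=L^p(X,\mu)$ and $\|g\|_{L^{p,\infty}}=\sup_{\lambda>0}\lambda\,\mu\{|g|>\lambda\}^{1/p}$; the norm of a sublinear operator is the least constant in the corresponding inequality (possibly $+\infty$). *)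

(* Defs.v *)
From mathcomp Require Import all_boot all_order all_algebra.
From mathcomp Require Import all_classical all_reals all_analysis.

Set Implicit Arguments.
Unset Strict Implicit.
Unset Printing Implicit Defensive.

Import Order.TTheory GRing.Theory Num.Theory.
Import numFieldNormedType.Exports.

Local Open Scope classical_set_scope.
Local Open Scope ring_scope.
Local Open Scope ereal_scope.

Definition log_plus (R : realType) (n : nat) : R :=
  Num.max 1%R (ln n%:R / ln 2)%R.

Section sparse_operators.
Context {disp : measure_display} {T : measurableType disp} {R : realType}.
Variable mu : {measure set T -> \bar R}.
Implicit Types (f : T -> R) (g : T -> \bar R) (BB SS : set (set T)).

(* Collections are sets of sets and need not be countable. *)

Definition average f (B : set T) : \bar R :=
  (mu B)^-1 * \int[mu]_(x in B) `|(f x)%:E|.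

(* The supremum is taken in [0, +oo]: it is 0, not -oo, when BB is empty. *)
Definition maximal_op BB f : T -> \bar R := fun x =>
  maxe 0 (ereal_sup [set average f B * (\1_B x)%:E | B in BB]).

Definition sparse_op SS f : T -> \bar R := fun x =>
  \esum_(S in SS) (average f S * (\1_S x)%:E).

(* For N > 0 this is a maximum over a nonempty index set, so the neutral
   element -oo plays no role. *)
Definition max_sparse_op N (SS : 'I_N -> set (set T)) f : T -> \bar R := fun x =>
  \big[maxe/-oo]_(k < N) sparse_op (SS k) f x.

Definition averageable SS : Prop :=
  forall S, SS S -> measurable S /\ 0 < mu S < +oo.

Definition sparse (gamma : R) SS : Prop :=
  exists E : set T -> set T,
    (forall S, SS S ->
       [/\ measurable (E S), E S `<=` S & gamma%:E * mu S <= mu (E S)]) /\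
    trivIset SS E.

Definition martingale BB : Prop :=
  (forall B, BB B -> measurable B) /\
  (forall A B, BB A -> BB B -> [\/ A `<=` B, B `<=` A | A `&` B = set0]).

Definition finite_martingale (d : nat) (C : R) BB : Prop :=
  exists BBk : 'I_d -> set (set T),
    (forall k, martingale (BBk k)) /\
    (forall B, BB B -> exists k B',
       [/\ BBk k B', B `<=` B' & mu B' <= C%:E * mu B]).

Definition finite_martingale_sparse (gamma : R) (d : nat) (C : R) SS : Prop :=
  [/\ averageable SS, sparse gamma SS & finite_martingale d C SS].

Definition weak_Lnorm (p : R) g : \bar R :=
  ereal_sup [set l%:E * (mu [set x | l%:E < `|g x|]) `^ p^-1
            | l in [set l : R | (0 < l)%R]].

(* Least constant A such that nrm (U f) <= A ||f||_p for all f in L^p; it is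
   +oo if there is no finite one. *)
Definition opnorm (p : R) (nrm : (T -> \bar R) -> \bar R)
    (U : (T -> R) -> T -> \bar R) : \bar R :=
  ereal_inf [set A%:E | A in [set A : R | (0 <= A)%R /\
    forall f, f \in Lfun mu p%:E ->
      nrm (U f) <= A%:E * 'N[mu]_p%:E[EFin \o f]]].

Definition weak_opnorm (p : R) U := opnorm p (weak_Lnorm p) U.

Definition strong_opnorm (p : R) U := opnorm p (Lnorm mu p%:E) U.

End sparse_operators.

(* Main.v *)
Require Import Defs.
From mathcomp Require Import all_boot all_order all_algebra.
From mathcomp Require Import all_classical all_reals all_analysis.
From mathcomp Require Import measurable_realfun ring lra.

(** Both bounds come from one comparison between Lambda = max_k Lambda_(S_k) f
    and M = M_S f, with constants depending only on q, gamma, d and C.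

    Suppose that the families are finite and that each of them is covered by a
    single martingale collection. Let N_F(x) be the number of sets of a
    subfamily F that contain x. Sparseness makes the covering sets pack: those
    inside a covering set B have total measure at most (C / gamma) mu(B). For
    nested-or-disjoint sets this packing forces exponential integrability,
      int ((1 + a)^(N_F) - 1) <= mu(union of F),    a = gamma / (2 C)
    ([integral_exp_depth_sparse]).

    Now sort the sets of each family by the dyadic size b / 2^l of the averages
    <f>_S. At level l all of them lie in {M > b / 2^(l+1)}, and
    Lambda_(S_k) f <= sum_l (b / 2^l) n_l, with n_l the overlap at level l. An
    elementary inequality between numbers ([sum_levels_powR]) gives, for q >= 1,
      (sum_l (b / 2^l) n_l)^q
        <= (c log_+ N M)^q + (c / N) sum_l (b / 2^l)^q ((1 + a)^(n_l) - 1):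
    either the dominating overlap is at most log_+ N times a factor that grows
    geometrically below the top level, which the decay of b / 2^l absorbs, or
    it is so large that the exponential pays for N and for all powers. The
    maximum over the N families is at most the sum of the last terms, which
    cancels the factor 1 / N. After integration the exponentials become
    sum_l (b / 2^l)^q mu{M > b / 2^(l+1)}, which is comparable to the integral
    of M^q. Hence int Lambda^q <= (c log_+ N)^q int M^q for every q >= 1
    ([max_step_sum_strong]).

    With q = p this is the strong bound. For the weak bound at height l, discard
    {M > s} with s = l / log_+ N; off this set only averages at most s occur, so
    the case q = p + 1 applies to min(M, s), whose (p + 1)-th power is
    integrable by the weak bound for M ([max_step_sum_weak]).

    The general case reduces to this one. A family may be uncountable, but only
    countably many of its sets carry a positive part of the finite integral of
    |f|^p ([countable_charged]), so Lambda and M are measurable functions and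
    increasing limits over finite subfamilies; and each family splits into d
    families, one for each martingale collection ([finite_approximation]). *)

Set Implicit Arguments.
Unset Strict Implicit.
Unset Printing Implicit Defensive.

Import Order.TTheory GRing.Theory Num.Theory.
Import numFieldNormedType.Exports.

Local Open Scope classical_set_scope.
Local Open Scope ring_scope.
Local Open Scope ereal_scope.

(** * Real inequalities *)

Section real_inequalities.
Context {R : realType}.
Local Open Scope ring_scope.

Lemma sum_geometric_tail (r : R) (l0 D : nat) : 0 <= r < 1 ->
  \sum_(l < D | (l0 <= l)%N) r ^+ l <= r ^+ l0 / (1 - r).
Proof.
move=> /andP[r0 r1]; rewrite ler_pdivlMr ?subr_gt0//.
suff <- : \sum_(l < D | (l0 <= l)%N) r ^+ l * (1 - r) + r ^+ maxn l0 D
          = r ^+ l0.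
  by rewrite mulr_suml lerDl exprn_ge0.
elim: D => [|D IH]; first by rewrite big_ord0 maxn0 add0r.
rewrite big_mkcond big_ord_recr/= -big_mkcond/=.
case: leqP => lD; last first.
  by rewrite addr0 -{}IH (maxn_idPl _)// (maxn_idPl _)// ltnW.
rewrite -{}IH (maxn_idPr _)// 1?leqW// (maxn_idPr _)// exprS; ring.
Qed.

Lemma sum_geometric_below (q b y : R) (D : nat) : 1 <= q -> 0 < b -> 0 <= y ->
  \sum_(l < D | b / 2 ^+ l < y) (b / 2 ^+ l) `^ q <= 2 * y `^ q.
Proof.
move=> q1 b0 y0.
have u0 l : 0 < b / 2 ^+ l by rewrite divr_gt0 ?exprn_gt0.
have [[l1 ly]|nol] := pselect (exists l : nat, b / 2 ^+ l < y); last first.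
  rewrite big1 ?mulr_ge0 ?powR_ge0// => l ly; exfalso; apply: nol.
  by exists (nat_of_ord l).
have ex : exists l, b / 2 ^+ l < y by exists l1.
case: (ex_minnP ex) => l0 l0y l0min.
rewrite -(mulr_powRB1 y0 (lt_le_trans ltr01 q1)).
apply: (@le_trans _ _ (\sum_(l < D | (l0 <= l)%N)
    (b * y `^ (q - 1)) * 2^-1 ^+ l)).
  rewrite [leLHS]big_mkcond [leRHS]big_mkcond; apply: ler_sum => l _.
  case: ifPn => [ly'|_]; last first.
    by case: ifP => // _; rewrite !mulr_ge0 ?powR_ge0 ?exprn_ge0// ltW.
  rewrite l0min// -(mulr_powRB1 (ltW (u0 l)) (lt_le_trans ltr01 q1)).
  rewrite exprVn [leRHS]mulrAC ler_wpM2l ?(ltW (u0 l))//.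
  by rewrite ge0_ler_powR ?nnegrE ?subr_ge0// ltW.
rewrite -mulr_sumr.
apply: (@le_trans _ _ (b * y `^ (q - 1) * (2^-1 ^+ l0 / (1 - 2^-1)))).
  rewrite ler_wpM2l ?mulr_ge0 ?powR_ge0 ?(ltW b0)//.
  by apply: sum_geometric_tail; lra.
have -> : b * y `^ (q - 1) * (2^-1 ^+ l0 / (1 - 2^-1))
    = 2 * (b / 2 ^+ l0) * y `^ (q - 1).
  by rewrite exprVn; field; rewrite expf_neq0//; lra.
by have := powR_ge0 y (q - 1); nra.
Qed.

(** In [sum_levels_powR] a factor (3/2)^s has to be paid for when (4/3)^s <= n;
    it is at most n^2, and this is where the cube comes from. *)
Lemma cube_powR_le_expR (t q : R) : 0 < t -> 1 <= q ->
  exists2 c : R, 0 < c & forall n : nat,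
    (3 * n%:R ^+ 3) `^ q <= c * expR (t * n%:R / 2).
Proof.
move=> t0 q1; have q0 : 0 < q by lra.
pose A := 6 * q / t; have A0 : 0 < A by rewrite divr_gt0// mulr_gt0.
exists ((3 * A ^+ 3) `^ q) => [|n].
  by rewrite powR_gt0// mulr_gt0// exprn_gt0.
have -> : expR (t * n%:R / 2) = (expR (n%:R / A) ^+ 3) `^ q.
  rewrite -powR_mulrn ?expR_ge0// -!expRM; congr expR.
  by rewrite /A; field; apply/andP; split; lra.
have nA : n%:R <= A * expR (n%:R / A).
  rewrite mulrC -ler_pdivrMr//; apply: le_trans (expR_ge1Dx _); lra.
clearbody A; have A0' := ltW A0.
have eA0 : 0 <= A * expR (n%:R / A) by rewrite mulr_ge0 ?expR_ge0.
rewrite -powRM ?mulr_ge0 ?exprn_ge0 ?expR_ge0//.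
rewrite -mulrA -exprMn.
apply: ge0_ler_powR; rewrite ?nnegrE ?mulr_ge0 ?exprn_ge0//; first exact: ltW.
by rewrite ler_wpM2l// lerXn2r ?nnegrE.
Qed.

Lemma log_plus_ge1 N : 1 <= log_plus R N.
Proof. by rewrite /log_plus le_max lexx. Qed.

Lemma le_expR_log_plus N : (1 <= N)%N ->
  N%:R <= expR (ln 2 * log_plus R N) /\ 2 <= expR (ln 2 * log_plus R N).
Proof.
move=> N1; have l2 : 0 < ln 2 :> R by rewrite ln_gt0// ltr1n.
split.
  rewrite -[leLHS]lnK ?posrE ?ltr0n// ler_expR.
  by rewrite mulrC -ler_pdivrMr// /log_plus le_max lexx orbT.
rewrite -[leLHS]lnK ?posrE// ler_expR.
by rewrite ler_peMr ?log_plus_ge1// ltW.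
Qed.

(** Half of the exponent beats the powers of n. The other half is at least N once
    n exceeds a multiple of log_+ N, and this pays for the division by N. *)
Lemma exp_dominates_cube (a q : R) : 0 < a -> 1 <= q ->
  exists k c : R, [/\ 1 <= k, 0 < c & forall N n : nat, (1 <= N)%N ->
    k * log_plus R N < n%:R ->
    (3 * n%:R ^+ 3) `^ q <= c / N%:R * ((1 + a) ^+ n - 1)].
Proof.
move=> a0 q1; pose t := ln (1 + a).
have t0 : 0 < t by rewrite ln_gt0// ltrDl.
have [c c0 cE] := cube_powR_le_expR t0 q1.
exists (1 + 2 * ln 2 / t), (2 * c).
have l2 : 0 < ln 2 :> R by rewrite ln_gt0// ltr1n.
have k1 : 0 < 2 * ln 2 / t by rewrite divr_gt0// mulr_gt0.
split; [lra|lra|move=> N n N1 kn].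
apply: le_trans (cE n) _.
have [EN E2] := le_expR_log_plus N1.
have L1 := log_plus_ge1 N.
set e := expR (t * n%:R / 2).
have He : expR (ln 2 * log_plus R N) <= e.
  rewrite ler_expR.
  have : (2 * ln 2 / t) * log_plus R N <= n%:R by nra.
  rewrite -(ler_pM2l t0) ler_pdivlMr//; congr (_ <= _).
  by field; rewrite gt_eqF.
have -> : (1 + a) ^+ n = e * e.
  rewrite -expRD -splitr expRM_natr.
  by rewrite lnK// posrE addr_gt0.
have N0 : 0 < N%:R :> R by rewrite ltr0n.
rewrite (_ : 2 * c / _ * _ = c * (2 * (e * e - 1) / N%:R)); last first.
  by field; rewrite gt_eqF.
rewrite ler_pM2l// ler_pdivlMr//.
have : N%:R <= e by lra.
have : 2 <= e by lra.
nra.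
Qed.
(** The geometric weights let one level i dominate the sum. If its overlap n_i is
    below k log_+ N, up to a factor geometric in the distance s from the top
    nonempty level, the sum is of the order of log_+ N times b / 2^(i-s) <= 2 V.
    Otherwise n_i also exceeds (4/3)^s, and the exponential of n_i dominates
    everything lost in passing from the top level to level i. *)
Lemma sum_levels_powR (a q : R) : 0 < a -> 1 <= q ->
  exists2 c : R, 0 < c & forall (N D : nat) (n : nat -> nat) (b V : R),
    (1 <= N)%N -> 0 < b -> 0 <= V ->
    (forall l, (l < D)%N -> (0 < n l)%N -> b / 2 ^+ l <= 2 * V) ->
    (\sum_(l < D) b / 2 ^+ l * (n l)%:R) `^ q <=
      (c * (log_plus R N * V)) `^ q +
      c / N%:R * \sum_(l < D) (b / 2 ^+ l) `^ q * ((1 + a) ^+ n l - 1).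
Proof.
move=> a0 q1; have q0 : 0 < q by lra.
have [k [c [k1 c0 kcE]]] := exp_dominates_cube a0 q1.
exists (6 * k + c) => [|N D n b V N1 b0 V0 nV]; first by lra.
have L1 := log_plus_ge1 N.
have N0 : 0 < N%:R :> R by rewrite ltr0n.
have u0 l : 0 < b / 2 ^+ l by rewrite divr_gt0 ?exprn_gt0.
have e0 m : 0 <= (1 + a) ^+ m - 1 by rewrite subr_ge0 exprn_ege1// lerDl ltW.
have tail0 : 0 <= \sum_(l < D) (b / 2 ^+ l) `^ q * ((1 + a) ^+ n l - 1).
  by apply: sumr_ge0 => l _; rewrite mulr_ge0 ?powR_ge0.
have cN : 0 <= (6 * k + c) / N%:R by rewrite divr_ge0 ?ler0n//; lra.
have [/existsP[i1 ni1]|] := boolP [exists l : 'I_D, (0 < n l)%N]; last first.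
  move=> /existsPn n0; rewrite big1 => [|l _].
    rewrite powR0 ?gt_eqF//.
    by apply: addr_ge0; [exact: powR_ge0|exact: mulr_ge0].
  by have := n0 l; rewrite -leqNgt leqn0 => /eqP ->; rewrite mulr0.
have ex : exists l : nat, (l < D)%N && (0 < n l)%N.
  by exists i1; rewrite ltn_ord.
case: (ex_minnP ex) => l0 /andP[l0D nl0] l0min.
have [i _ imax] := @arg_maxP _ R _ i1 predT
  (fun l : 'I_D => (3 / 4) ^+ l * (n l)%:R) erefl.
have ni : (0 < n i)%N.
  rewrite lt0n; apply/eqP => ni; have := imax i1 erefl.
  rewrite /= ni mulr0 leNgt mulr_gt0 ?ltr0n ?exprn_gt0//; lra.
have l0i : (l0 <= i)%N by apply: l0min; rewrite ltn_ord.
set s := (i - l0)%N; have iE : nat_of_ord i = (l0 + s)%N by rewrite subnKC.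
set X := \sum_(l < D) _.
(* 1/2 = (2/3)(3/4): the factor (3/4)^l is absorbed in the maximum and the
   geometric series of ratio 2/3 remains. *)
have XE : X <= 3 * (b / 2 ^+ l0) * ((3 / 4) ^+ s * (n i)%:R).
  apply: (@le_trans _ _ (\sum_(l < D | (l0 <= l)%N)
      (b * ((3 / 4) ^+ i * (n i)%:R)) * (2 / 3) ^+ l)).
    rewrite [leRHS]big_mkcond; apply: ler_sum => l _.
    case: leqP => [l0l|ll0]; last first.
      case: (posnP (n l)) => [->|nl]; first by rewrite mulr0.
      by have := l0min l; rewrite ltn_ord nl leqNgt ll0 => /(_ erefl).
    have -> : b / 2 ^+ l * (n l)%:R =
        b * ((3 / 4) ^+ l * (n l)%:R) * (2 / 3) ^+ l.
      have -> : (2 : R) ^+ l = (4 / 3) ^+ l * (3 / 2) ^+ l.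
        by rewrite -exprMn; congr (_ ^+ _); lra.
      rewrite !expr_div_n; field.
      by rewrite !expf_neq0//; lra.
    rewrite ler_wpM2r ?exprn_ge0//.
    rewrite ler_wpM2l ?(ltW b0)//; exact: imax.
  rewrite -mulr_sumr.
  apply: (@le_trans _ _ (b * ((3 / 4) ^+ i * (n i)%:R) *
      ((2 / 3) ^+ l0 / (1 - 2 / 3)))).
    rewrite ler_wpM2l ?sum_geometric_tail//; last by apply/andP; split; lra.
    by rewrite !mulr_ge0 ?ler0n ?exprn_ge0 ?(ltW b0)//; lra.
  rewrite iE exprD; have -> : (2 : R) ^+ l0 = (4 / 3) ^+ l0 * (3 / 2) ^+ l0.
    by rewrite -exprMn; congr (_ ^+ _); lra.
  rewrite le_eqVlt; apply/orP; left; apply/eqP; rewrite !expr_div_n.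
  by field; rewrite ?expf_neq0//; lra.
have X0 : 0 <= X by apply: sumr_ge0 => l _; rewrite mulr_ge0 ?ler0n ?(ltW (u0 l)).
have uV := nV _ l0D nl0.
have [small|big] := leP ((3 / 4) ^+ s * (n i)%:R) (k * log_plus R N).
  apply: ler_wpDr; first exact: mulr_ge0.
  apply: ge0_ler_powR; rewrite ?nnegrE ?(ltW q0)//.
    by rewrite !mulr_ge0//; lra.
  apply: (le_trans XE); apply: (@le_trans _ _ (3 * (2 * V) * (k * log_plus R N))).
    apply: ler_pM => //; rewrite ?mulr_ge0 ?ler0n ?exprn_ge0 ?(ltW (u0 l0))//.
      by lra.
    by rewrite ler_wpM2l.
  by rewrite (_ : _ * _ = 6 * k * (log_plus R N * V)) ?ler_wpM2r ?mulr_ge0//; lra.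
apply: ler_wpDl; first exact: powR_ge0.
apply: (@le_trans _ _ ((6 * k + c) / N%:R *
   ((b / 2 ^+ i) `^ q * ((1 + a) ^+ n i - 1)))); last first.
  rewrite ler_wpM2l// (bigD1 i)//= lerDl.
  by apply: sumr_ge0 => l _; rewrite mulr_ge0 ?powR_ge0.
have nR : 1 <= (n i)%:R :> R by rewrite ler1n.
have p34 : 0 < (3 / 4 : R) ^+ s by rewrite exprn_gt0//; lra.
have p34' : (3 / 4 : R) ^+ s <= 1 by rewrite exprn_ile1//; lra.
have n43 : (4 / 3 : R) ^+ s <= (n i)%:R.
  have -> : (4 / 3 : R) ^+ s = ((3 / 4) ^+ s)^-1.
    by rewrite -exprVn; congr (_ ^+ _); lra.
  by rewrite -[leLHS]mul1r ler_pdivrMr//; nra.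
have step : X <= (3 * (n i)%:R ^+ 3) * (b / 2 ^+ i).
  apply: (le_trans XE).
  have -> : 3 * (b / 2 ^+ l0) * ((3 / 4) ^+ s * (n i)%:R) =
      (b / 2 ^+ i) * (3 * (3 / 2) ^+ s * (n i)%:R).
    rewrite iE exprD; have -> : (2 : R) ^+ s = (4 / 3) ^+ s * (3 / 2) ^+ s.
      by rewrite -exprMn; congr (_ ^+ _); lra.
    by rewrite !expr_div_n; field; rewrite ?expf_neq0//; lra.
  rewrite mulrC ler_pM2r// exprSr mulrA ler_pM2r; last by lra.
  rewrite ler_pM2l; last by lra.
  apply: (@le_trans _ _ (((4 / 3 : R) ^+ s) ^+ 2)); last first.
    by rewrite lerXn2r ?nnegrE ?ler0n ?exprn_ge0//; lra.
  rewrite -exprM mulnC exprM lerXn2r ?nnegrE ?exprn_ge0//; lra.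
apply: (@le_trans _ _ ((3 * (n i)%:R ^+ 3) `^ q * (b / 2 ^+ i) `^ q)).
  have ui0 := ltW (u0 i).
  have n30 : 0 <= 3 * (n i)%:R ^+ 3 :> R by rewrite mulr_ge0 ?exprn_ge0.
  rewrite -powRM//; apply: ge0_ler_powR; rewrite ?nnegrE ?(ltW q0)//.
  exact: le_trans step.
rewrite [leLHS]mulrC [leRHS]mulrCA ler_wpM2l ?powR_ge0//.
apply: (@le_trans _ _ (c / N%:R * ((1 + a) ^+ n i - 1))).
  by apply: kcE => //; apply: lt_le_trans big _; nra.
rewrite ler_wpM2r// ler_wpM2r ?invr_ge0 ?ler0n//; lra.
Qed.

End real_inequalities.

(** * Packing and exponential integrability *)

(** The number of members of F inside B i is a rank for inclusion, so the
    maximum of this number is attained at a maximal set. *)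
Lemma laminar_maximal (J : finType) (T : Type) (B : J -> set T) (F : {set J}) :
  (forall i j, [\/ B i `<=` B j, B j `<=` B i | B i `&` B j = set0]) ->
  F != finset.set0 ->
  exists2 i, i \in F &
    forall j, j \in F -> B i `&` B j !=set0 -> B j `<=` B i.
Proof.
move=> lamB /set0Pn[i0 i0F].
pose down i := [set j in F | `[< B j `<=` B i >]].
case: (@arg_maxnP _ i0 (fun i => i \in F) (fun i => #|down i|)) => // i iF imax.
exists i => // j jF [x [Bix Bjx]].
have [ij|//|ij0] := lamB i j; last first.
  by have : (B i `&` B j) x by []; rewrite ij0.
have down_sub : down i \subset down j.
  apply/fintype.subsetP => k; rewrite !inE => /andP[-> /asboolP ki].
  by apply/asboolP; exact: subset_trans ij.
have /eqP down_eq : down i == down j by rewrite eqEcard down_sub; exact: imax.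
have : j \in down j by rewrite !inE jF; exact/asboolP.
by rewrite -down_eq !inE => /andP[_ /asboolP].
Qed.

Definition depth (T : Type) (J : finType) (B : J -> set T) (F : {set J}) (x : T) :=
  #|[set j in F | x \in B j]|.

Section exponential_integrability.
Context {disp : measure_display} {T : measurableType disp} {R : realType}.
Variable mu : {measure set T -> \bar R}.

Lemma depthD1 (J : finType) (B : J -> set T) (F : {set J}) i x : i \in F ->
  depth B F x = ((x \in B i) + depth B (F :\ i) x)%N.
Proof.
move=> iF; rewrite /depth (cardsD1 i) !inE iF/=; congr (_ + _)%N.
by apply: eq_card => j; rewrite !inE andbA.
Qed.

Lemma exp_depthE (J : finType) (B : J -> set T) (F : {set J}) (b : R) x :
  ((1 + b) ^+ depth B F x = \prod_(j in F) (1 + b * \1_(B j) x))%R.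
Proof.
rewrite (bigID (fun j => x \in B j))/= [X in (_ * X)%R]big1 ?mulr1; last first.
  by move=> j /andP[_ /negbTE xj]; rewrite indicE xj mulr0 addr0.
rewrite (eq_bigr (fun=> 1 + b)%R); last first.
  by move=> j /andP[_ xj]; rewrite indicE xj mulr1.
rewrite prodr_const; congr (_ ^+ _)%R; apply: eq_card => j.
by rewrite !inE unfold_in/=.
Qed.

Lemma measurable_exp_depth (J : finType) (B : J -> set T) (F : {set J}) (b : R) :
  (forall j, measurable (B j)) ->
  measurable_fun setT (fun x => ((1 + b) ^+ depth B F x - 1)%R).
Proof.
move=> mB; apply: measurable_funB => //.
rewrite (_ : (fun _ => _) = fun x => (\prod_(j <- enum F) (1 + b * \1_(B j) x))%R).
  apply: measurable_prod => j _; apply: measurable_funD => //.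
  by apply: measurable_funM => //; exact: measurable_indic.
by apply/funext => x; rewrite exp_depthE big_enum.
Qed.

Lemma exp_depth_ge0 (J : finType) (B : J -> set T) (F : {set J}) (b : R) x :
  (0 <= b)%R -> 0 <= ((1 + b) ^+ depth B F x - 1)%:E.
Proof. by move=> b0; rewrite lee_fin subr_ge0 exprn_ege1// lerDl. Qed.

(** Removing a maximal set of the family splits off its own measure and the
    exponential integral of the sets inside it, which the packing condition
    makes no larger than that measure. *)
Lemma integral_exp_depth_le (J : finType) (B : J -> set T) (a K : R) :
  (0 <= a)%R -> (2 * a * K <= 1)%R -> (forall j, measurable (B j)) ->
  (forall i j, [\/ B i `<=` B j, B j `<=` B i | B i `&` B j = set0]) ->
  (forall (F : {set J}) i, \sum_(j in F | `[< B j `<=` B i >]) mu (B j) <=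
    K%:E * mu (B i)) ->
  forall F : {set J},
  \int[mu]_x ((1 + a) ^+ depth B F x - 1)%:E <=
    (2 * a)%:E * \sum_(j in F) mu (B j).
Proof.
move=> a0 aK mB lamB packB F; have [n] := ubnP #|F|; elim: n F => // n IH F Fn.
have [->|F0] := eqVneq F finset.set0.
  rewrite big_set0 mule0 integral0_eq// => x _; rewrite /depth.
  rewrite (_ : [set j in _ | _] = finset.set0) ?cards0 ?expr0 ?subrr//.
  by apply/finset.setP => j; rewrite !inE.
have [i iF imax] := laminar_maximal lamB F0.
(* On B i the depth of F' is that of G, since B i is maximal. *)
pose F' := F :\ i; pose G := [set j in F' | `[< B j `<=` B i >]].
have F'n : (#|F'| < n)%N by move: Fn; rewrite (cardsD1 i F) iF.
have Gn : (#|G| < n)%N.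
  apply: leq_ltn_trans F'n; apply: subset_leq_card.
  by apply/fintype.subsetP => j; rewrite inE => /andP[].
have W0 F1 x : 0 <= ((1 + a) ^+ depth B F1 x - 1)%:E by exact: exp_depth_ge0.
have mW F1 : measurable_fun setT (fun x => ((1 + a) ^+ depth B F1 x - 1)%:E).
  by apply/measurable_EFinP; exact: measurable_exp_depth.
have m1 : measurable_fun setT (fun x => a%:E * (\1_(B i) x)%:E).
  by apply: emeasurable_funM => //; apply/measurable_EFinP; exact: measurable_indic.
have aE : 0 <= a%:E by rewrite lee_fin.
apply: (@le_trans _ _ (\int[mu]_x (((1 + a) ^+ depth B F' x - 1)%:E +
   (a%:E * (\1_(B i) x)%:E + a%:E * ((1 + a) ^+ depth B G x - 1)%:E)))).
  apply: ge0_le_integral => //.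
    by apply: emeasurable_funD => //; apply: emeasurable_funD => //; exact: emeasurable_funM.
  move=> x _; rewrite (depthD1 _ _ iF) -/F' -!EFinM -!EFinD lee_fin indicE.
  have [Bix|_] := boolP (x \in B i); last first.
    by rewrite add0n mulr0 add0r lerDl mulr_ge0// -lee_fin.
  rewrite add1n exprS mulr1.
  have : ((1 + a) ^+ depth B F' x <= (1 + a) ^+ depth B G x)%R.
    rewrite ler_weXn2l ?lerDl// subset_leq_card//.
    apply/fintype.subsetP => j; rewrite !inE => /andP[/andP[ji jF] xj].
    rewrite ji jF xj /= andbT; apply/asboolP/imax => //.
    by exists x; split; exact: set_mem.
  nra.
rewrite ge0_integralD//; last 2 first.
  by move=> x _; rewrite adde_ge0// mule_ge0// lee_fin.
  by apply: emeasurable_funD => //; exact: emeasurable_funM.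
rewrite ge0_integralD//; last 3 first.
  by move=> x _; rewrite mule_ge0// lee_fin.
  by move=> x _; rewrite mule_ge0.
  exact: emeasurable_funM.
rewrite (bigD1 i)//= ge0_muleDr//; last by apply: sume_ge0.
rewrite [leRHS]addeC leeD//.
  by rewrite (eq_bigl (fun j => j \in F')) ?IH// => j; rewrite !inE andbC.
rewrite !ge0_integralZl//; last first.
  by apply/measurable_EFinP; exact: measurable_indic.
rewrite integral_indic// setIT -ge0_muleDr//; last exact: integral_ge0.
rewrite mulrC mulr_natr mulr2n EFinD ge0_muleDl//.
rewrite -ge0_muleDr// lee_wpmul2l// leeD2l//.
apply: (le_trans (IH _ Gn)).
apply: (@le_trans _ _ ((2 * a)%:E * (K%:E * mu (B i)))).
  rewrite lee_wpmul2l// ?lee_fin ?mulr_ge0//.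
  apply: le_trans (packB F i).
  rewrite [leLHS]big_mkcond [leRHS]big_mkcond; apply: lee_sum => j _.
  rewrite !inE; case: ifPn => [/andP[/andP[_ ->] ->]//|_].
  by case: ifP.
rewrite muleA -EFinM -[leRHS]mul1e lee_wpmul2r// lee_fin.
Qed.

Lemma sum_measure_disjoint_le (J : finType) (E : J -> set T) (F : {set J}) U :
  (forall j, measurable (E j)) -> measurable U -> trivIset setT E ->
  (forall j, j \in F -> E j `<=` U) ->
  \sum_(j in F) mu (E j) <= mu U.
Proof.
move=> mE mU trivE EU.
have m1 (A : set T) : measurable A ->
    measurable_fun setT (fun x => (\1_A x : R)%:E).
  by move=> mA; apply/measurable_EFinP; exact: measurable_indic.
have -> : \sum_(j in F) mu (E j) =
    \int[mu]_x \sum_(j <- enum F) (\1_(E j) x)%:E.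
  rewrite ge0_integral_sum//; last by move=> j; exact: m1.
  by rewrite big_enum; apply: eq_bigr => j _; rewrite integral_indic// setIT.
have -> : mu U = \int[mu]_x (\1_U x)%:E by rewrite integral_indic// setIT.
apply: ge0_le_integral => //; last 2 first.
- exact: m1.
- move=> x _; rewrite sumEFin lee_fin.
  have [[j [jF Ejx]]|no] := pselect (exists j, j \in F /\ E j x).
    rewrite big_enum/= (bigD1 j)//= big1 ?addr0 => [|k /andP[kF kj]].
      by rewrite !indicE !mem_set//; exact: EU Ejx.
    rewrite indicE memNset// => Ekx; move/eqP: kj; apply.
    by apply: trivE => //; exists x.
  rewrite big_enum/= big1// => j jF; rewrite indicE memNset// => Ejx.
  by apply: no; exists j.
- by move=> x _; apply: sume_ge0 => j _; rewrite lee_fin.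
- by apply: emeasurable_sum => j; exact: m1.
Qed.

(** A sparse family together with the sets of one martingale collection that
    cover it; indices replace membership so that empty sets may serve as
    padding. *)
Record sparse_tower (gamma C : R) (J : Type) (S B E : J -> set T) : Prop :=
  SparseTower {
    tower_measurable : forall j, [/\ measurable (S j), measurable (B j) &
                                     measurable (E j)];
    tower_sub : forall j, E j `<=` S j /\ S j `<=` B j;
    tower_sparse : forall j, gamma%:E * mu (S j) <= mu (E j);
    tower_cover : forall j, mu (B j) <= C%:E * mu (S j);
    tower_disjoint : trivIset setT E;
    tower_laminar : forall i j,
      [\/ B i `<=` B j, B j `<=` B i | B i `&` B j = set0] }.

(** Sparseness is used twice: inside each covering set it gives the packing
    constant C / gamma, and over the whole family it bounds the total measure of
    the covering sets by (C / gamma) mu(U). The parameter gamma / (2 C) makes both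
    constants cancel. *)
Lemma integral_exp_depth_sparse (gamma C : R) (J : finType)
    (S B E : J -> set T) (F : {set J}) (U : set T) :
  (0 < gamma)%R -> (0 < C)%R -> sparse_tower gamma C S B E ->
  measurable U -> (forall j, j \in F -> S j `<=` U) ->
  \int[mu]_x ((1 + gamma / (2 * C)) ^+ depth S F x - 1)%:E <= mu U.
Proof.
move=> g0 C0 [mSBE sub sp cov triv lam] mU SU.
set a := (gamma / (2 * C))%R.
have a0 : (0 <= a)%R by rewrite divr_ge0 ?mulr_ge0// ltW.
have mS j : measurable (S j) by case: (mSBE j).
have mB j : measurable (B j) by case: (mSBE j).
have mE j : measurable (E j) by case: (mSBE j).
have gC0 : (0 <= C / gamma)%R by rewrite divr_ge0// ltW.
have BE j : mu (B j) <= (C / gamma)%:E * mu (E j).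
  apply: (le_trans (cov j)); rewrite EFinM -muleA lee_wpmul2l ?lee_fin ?(ltW C0)//.
  apply: (@le_trans _ _ ((gamma^-1)%:E * (gamma%:E * mu (S j)))).
    by rewrite muleA -EFinM mulVf ?mul1e// gt_eqF.
  by rewrite lee_wpmul2l// lee_fin invr_ge0 ltW.
have aK : (2 * a * (C / gamma) = 1)%R.
  by rewrite /a; field; rewrite !gt_eqF.
clearbody a.
apply: (@le_trans _ _ (\int[mu]_x ((1 + a) ^+ depth B F x - 1)%:E)).
  apply: ge0_le_integral => //.
  - by move=> x _; exact: exp_depth_ge0.
  - by apply/measurable_EFinP; exact: measurable_exp_depth.
  - by apply/measurable_EFinP; exact: measurable_exp_depth.
  move=> x _; rewrite lee_fin lerB// ler_weXn2l ?lerDl// subset_leq_card//.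
  apply/fintype.subsetP => j; rewrite !inE => /andP[-> xj]/=.
  by apply/mem_set/(sub j).2/set_mem.
apply: (@le_trans _ _ ((2 * a)%:E * \sum_(j in F) mu (B j))).
  apply: (@integral_exp_depth_le _ _ _ (C / gamma)) => //; first by rewrite aK.
  move=> F1 i.
  apply: (@le_trans _ _ (\sum_(j in F1 | `[< B j `<=` B i >])
      (C / gamma)%:E * mu (E j))); first by apply: lee_sum => j _.
  rewrite -ge0_sume_distrr// lee_wpmul2l ?lee_fin//.
  rewrite (eq_bigl (fun j => j \in [set j in F1 | `[< B j `<=` B i >]])); last first.
    by move=> j; rewrite !inE.
  apply: sum_measure_disjoint_le => // j; rewrite inE => /andP[_ /asboolP BjBi].
  exact: subset_trans (subset_trans (sub j).1 (sub j).2) BjBi.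
apply: (@le_trans _ _ ((2 * a)%:E * ((C / gamma)%:E * mu U))).
  rewrite lee_wpmul2l ?lee_fin ?mulr_ge0//.
  apply: (@le_trans _ _ (\sum_(j in F) (C / gamma)%:E * mu (E j))).
    by apply: lee_sum => j _.
  rewrite -ge0_sume_distrr// lee_wpmul2l ?lee_fin//.
  apply: sum_measure_disjoint_le => // j jF.
  by apply: subset_trans (sub j).1 _; exact: SU.
by rewrite muleA -EFinM aK mul1e.
Qed.
End exponential_integrability.

(** * The strong bound for finite families *)

Section finite_bounds.
Context {R : realType}.

Lemma depth_sum {T : Type} (J : finType) (S : J -> set T) (F : {set J}) x :
  ((depth S F x)%:R = \sum_(j in F) \1_(S j) x :> R)%R.
Proof.
rewrite (bigID (fun j => x \in S j))/= [X in (_ + X)%R]big1 ?addr0; last first.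
  by move=> j /andP[_ /negbTE xj]; rewrite indicE xj.
rewrite (eq_bigr (fun=> 1)%R); last by move=> j /andP[_ xj]; rewrite indicE xj.
rewrite sumr_const; congr (_ *+ _)%R; apply: eq_card => j.
by rewrite !inE unfold_in/=.
Qed.

Definition step_sum {T : Type} (J : finType) (S : J -> set T) (al : J -> R) x :=
  (\sum_j al j * \1_(S j) x)%R.

Definition max_step_sum {T : Type} (K J : finType) (S : K -> J -> set T)
    (al : K -> J -> R) x :=
  (\big[Num.max/0%R]_k step_sum (S k) (al k) x)%R.

Lemma measurable_step_sum {disp} {T : measurableType disp} (J : finType)
    (S : J -> set T) (al : J -> R) :
  (forall j, measurable (S j)) -> measurable_fun setT (step_sum S al).
Proof.
move=> mS; apply: measurable_sum => j.
by apply: measurable_funM => //; exact: measurable_indic.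
Qed.

Lemma measurable_superlevel {disp} {T : measurableType disp} (f : T -> R)
    (t : R) :
  measurable_fun setT f -> measurable [set x | (t < f x)%R].
Proof.
move=> /measurable_EFinP mf.
have := emeasurable_fun_o_infty measurableT mf t%:E; rewrite setTI.
by congr measurable; apply/funext => x /=; rewrite lte_fin.
Qed.

Lemma measurable_bigmaxr {disp} {T : measurableType disp} (K : Type)
    (s : seq K) (f : K -> T -> R) :
  (forall k, measurable_fun setT (f k)) ->
  measurable_fun setT (fun x => (\big[Num.max/0%R]_(k <- s) f k x)%R).
Proof.
move=> mf; elim: s => [|k s IH].
  by under eq_fun do rewrite big_nil; exact: measurable_cst.
by under eq_fun do rewrite big_cons; exact: measurable_maxr.
Qed.

Lemma measurable_max_step_sum {disp} {T : measurableType disp} (K J : finType)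
    (S : K -> J -> set T) (al : K -> J -> R) :
  (forall k j, measurable (S k j)) -> measurable_fun setT (max_step_sum S al).
Proof. by move=> mS; apply: measurable_bigmaxr => k; exact: measurable_step_sum. Qed.

Lemma step_sum_ge0 {T : Type} (J : finType) (S : J -> set T) (al : J -> R) x :
  (forall j, 0 <= al j)%R -> (0 <= step_sum S al x)%R.
Proof. by move=> al0; apply: sumr_ge0 => j _; rewrite mulr_ge0. Qed.

Lemma dyadic_level (b y : R) : (0 < y)%R -> (y <= b)%R ->
  exists l, (b / 2 ^+ l < 2 * y)%R /\ (y <= b / 2 ^+ l)%R.
Proof.
move=> y0 yb.
have ex : exists l : nat, (b / 2 ^+ l < 2 * y)%R.
  have b0 : (0 < b)%R by exact: lt_le_trans yb.
  have [m bm] : exists m, (b / y < m%:R)%R.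
    by exists (Num.bound (b / y)); rewrite archi_boundP// divr_ge0 ?(ltW b0)// ltW.
  exists m; rewrite ltr_pdivrMr ?exprn_gt0//.
  have : (m%:R <= 2 ^+ m :> R)%R by rewrite -natrX ler_nat ltnW// ltn_expl.
  by move: bm; rewrite ltr_pdivrMr//; nra.
case: (ex_minnP ex) => -[|l] lP lmin.
  by exists 0%N; split => //; rewrite expr0 divr1.
exists l.+1; split => //; rewrite leNgt; apply/negP => yl.
have : (b / 2 ^+ l < 2 * y)%R.
  have -> : (b / 2 ^+ l = 2 * (b / 2 ^+ l.+1))%R.
    by rewrite exprS; field; rewrite expf_neq0.
  by rewrite ltr_pM2l.
by move=> /lmin; rewrite ltnn.
Qed.

(** The sets are sorted by the dyadic size of their coefficients: at level l all
    of them lie where 2 V exceeds b / 2 ^ l, so the exponential integral of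
    their overlap is at most the measure of that region, and summing over the
    levels rebuilds the integral of V ^ q. *)
Lemma max_step_sum_strong (gamma C : R) (d : nat) (q : R) :
  (0 < gamma)%R -> (0 < C)%R -> (1 <= q)%R ->
  exists2 c : R, (0 < c)%R &
    forall (disp : measure_display) (T : measurableType disp)
      (mu : {measure set T -> \bar R}) (K J : finType) (N : nat)
      (S B E : K -> J -> set T) (al : K -> J -> R) (V : T -> R),
    (1 <= N)%N -> (#|K| <= d * N)%N ->
    (forall k, sparse_tower mu gamma C (S k) (B k) (E k)) ->
    (forall k j, 0 <= al k j)%R ->
    measurable_fun setT V -> (forall x, 0 <= V x)%R ->
    (forall k j x, S k j x -> al k j <= V x)%R ->
    \int[mu]_x (max_step_sum S al x `^ q)%:E <=
      ((c * log_plus R N) `^ q)%:E * \int[mu]_x (V x `^ q)%:E.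
Proof.
move=> g0 C0 q1; have q0 : (0 < q)%R by exact: lt_le_trans q1.
pose a := (gamma / (2 * C))%R; have a0 : (0 < a)%R by rewrite divr_gt0// mulr_gt0.
have [c c0 cP] := sum_levels_powR a0 q1.
(* The second summand is the cost of the exponential terms: a factor d from the
   number of families, and 2 (2 V)^q from [sum_geometric_below]. *)
pose c2 := (c `^ q + d%:R * c * (2 * 2 `^ q))%R.
have c2p : (0 < c2)%R.
  by rewrite ltr_wpDr ?powR_gt0// !mulr_ge0 ?powR_ge0// ltW.
exists (c2 `^ q^-1)%R; first exact: powR_gt0.
move=> disp T mu K J N S B E al V N1 KN tower al0 mV V0 alV.
set L := log_plus R N; have L1 : (1 <= L)%R by exact: log_plus_ge1.
have mS k j : measurable (S k j) by case: (tower_measurable (tower k) j).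
(* Any common positive upper bound of the coefficients serves as top level. *)
pose b := (\sum_k \sum_j al k j + 1)%R.
have b0 : (0 < b)%R by rewrite ltr_wpDl// sumr_ge0// => k _; exact: sumr_ge0.
have alb k j : (al k j <= b)%R.
  rewrite /b (bigD1 k)//= (bigD1 j)//= -!addrA lerDl !addr_ge0//.
    by apply: sumr_ge0.
  by apply: sumr_ge0 => i _; exact: sumr_ge0.
have /choice[lev levP] : forall p : K * J, exists l, (0 < al p.1 p.2)%R ->
    (b / 2 ^+ l < 2 * al p.1 p.2)%R /\ (al p.1 p.2 <= b / 2 ^+ l)%R.
  move=> [k j]/=.
  have [alp|_] := ltP 0%R (al k j); last by exists 0%N.
  by have [l lP] := dyadic_level alp (alb k j); exists l.
pose D := (\sum_p lev p).+1.
have levD p : (lev p < D)%N by rewrite /D ltnS (bigD1 p)//= leq_addr.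
pose F k (l : nat) : {set J} := [set j | (0 < al k j)%R && (lev (k, j) == l)]%SET.
pose n k (x : T) l := depth (S k) (F k l) x.
pose Om (l : nat) := [set x | b / 2 ^+ l < 2 * V x]%R.
have mOm l : measurable (Om l).
  by apply: measurable_superlevel; exact: measurable_funM.
have SOm k l j : j \in F k l -> S k j `<=` Om l.
  rewrite inE => /andP[alp /eqP <-] x Sx /=.
  have [/= lo _] := levP (k, j) alp.
  by apply: (lt_le_trans lo); rewrite ler_pM2l// alV.
have step_le k x : (step_sum (S k) (al k) x <=
    \sum_(l < D) b / 2 ^+ l * (n k x l)%:R)%R.
  rewrite /n; under eq_bigr do rewrite depth_sum mulr_sumr big_mkcond/=.
  rewrite exchange_big/=; apply: ler_sum => j _.
  have tge0 (l : 'I_D) :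
      (0 <= if j \in F k l then b / 2 ^+ l * \1_(S k j) x else 0 :> R)%R.
    by case: ifP => // _; rewrite mulr_ge0// divr_ge0 ?exprn_ge0 ?(ltW b0).
  have [alp|alp] := ltP 0%R (al k j); last first.
    have -> : al k j = 0%R by apply/eqP; rewrite eq_le alp al0.
    by rewrite mul0r; apply: sumr_ge0 => l _.
  rewrite (bigD1 (Ordinal (levD (k, j))))//= inE alp eqxx/=.
  rewrite ler_wpDr ?sumr_ge0// ler_wpM2r//.
  by have [] := levP (k, j) alp.
pose w (l : nat) := (c / N%:R * (b / 2 ^+ l) `^ q)%R.
have w0 l : (0 <= w l)%R by rewrite !mulr_ge0 ?powR_ge0 ?invr_ge0// ltW.
pose W k (l : 'I_D) (x : T) := ((1 + a) ^+ n k x l - 1)%R.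
have W0 k l x : (0 <= W k l x)%R.
  by rewrite -lee_fin; apply: exp_depth_ge0; exact: ltW.
have point x : (max_step_sum S al x `^ q <=
    (c * L) `^ q * V x `^ q + \sum_(p : K * 'I_D) w p.2 * W p.1 p.2 x)%R.
  rewrite -(pair_bigA _ (fun k (l : 'I_D) => w l * W k l x)%R)/=.
  have R0 k : (0 <= \sum_(l < D) w l * W k l x)%R.
    by apply: sumr_ge0 => l _; rewrite mulr_ge0.
  have H k : (step_sum (S k) (al k) x `^ q <= (c * L) `^ q * V x `^ q +
      \sum_k \sum_(l < D) w l * W k l x)%R.
    apply: (@le_trans _ _ ((c * (L * V x)) `^ q +
        c / N%:R * \sum_(l < D) (b / 2 ^+ l) `^ q * W k l x)%R).
      apply: (@le_trans _ _
          ((\sum_(l < D) b / 2 ^+ l * (n k x l)%:R) `^ q)%R).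
        have ge0 := step_sum_ge0 (S k) x (al0 k).
        apply: ge0_ler_powR => //; rewrite ?nnegrE ?(ltW q0)//.
        exact: le_trans (step_le k x).
      apply: cP => // l lD; rewrite /n /depth card_gt0 => /set0Pn[j].
      by rewrite inE => /andP[jF /set_mem Sj]; exact/ltW/(SOm _ _ _ jF).
    rewrite mulrA powRM ?mulr_ge0 ?(ltW c0) ?(le_trans ler01 L1)//.
    rewrite lerD2l (bigD1 k)//= mulr_sumr.
    rewrite ler_wpDr ?sumr_ge0//; apply: ler_sum => l _.
    by rewrite mulrA.
  rewrite /max_step_sum.
  suff [] : (0 <= \big[Num.max/0]_k step_sum (S k) (al k) x)%R /\
    ((\big[Num.max/0]_k step_sum (S k) (al k) x) `^ q <=
     (c * L) `^ q * V x `^ q + \sum_k \sum_(l < D) w l * W k l x)%R by [].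
  elim/big_ind : _ => [|u v [u0 uq] [v0 vq]|k _].
  - rewrite powR0 ?gt_eqF//; split => //.
    by rewrite addr_ge0 ?mulr_ge0 ?powR_ge0// sumr_ge0.
  - by rewrite /Num.max; case: ifP.
  - by split; [exact: step_sum_ge0|exact: H].
have mpowV (r : R) : measurable_fun setT (fun x => (V x `^ r)%:E).
  by apply/measurable_EFinP; exact: (measurableT_comp (measurable_powR _)).
have mW k l : measurable_fun setT (fun x => (W k l x)%:E).
  by apply/measurable_EFinP; exact: measurable_exp_depth.
have m1 l : measurable_fun setT (fun x => (\1_(Om l) x : R)%:E).
  by apply/measurable_EFinP; exact: measurable_indic.
have cL0 : (0 <= (c * L) `^ q)%R by exact: powR_ge0.
apply: (@le_trans _ _ (\int[mu]_x (((c * L) `^ q)%:E * (V x `^ q)%:E +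
    \sum_(p <- enum {: K * 'I_D}) (w p.2)%:E * (W p.1 p.2 x)%:E))).
  apply: ge0_le_integral => //.
  - by move=> x _; rewrite lee_fin powR_ge0.
  - apply/measurable_EFinP; apply: (measurableT_comp (measurable_powR _)).
    exact: measurable_max_step_sum.
  - apply: emeasurable_funD; first exact: emeasurable_funM.
    by apply: emeasurable_sum => p; exact: emeasurable_funM.
  move=> x _; rewrite big_enum/= -EFinM.
  by under eq_bigr do rewrite -EFinM; rewrite sumEFin -EFinD lee_fin.
have wW0 (p : K * 'I_D) x : 0 <= (w p.2)%:E * (W p.1 p.2 x)%:E.
  by rewrite mule_ge0 ?lee_fin.
rewrite ge0_integralD//; last 4 first.
- by move=> x _; rewrite mule_ge0 ?lee_fin ?powR_ge0.
- exact: emeasurable_funM.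
- by move=> x _; apply: sume_ge0 => p _.
- by apply: emeasurable_sum => p; exact: emeasurable_funM.
rewrite ge0_integralZl//; last by move=> x _; rewrite lee_fin powR_ge0.
apply: (@le_trans _ _ (((c * L) `^ q)%:E * \int[mu]_x (V x `^ q)%:E +
   \int[mu]_x ((d%:R * c * (2 * 2 `^ q))%:E * (V x `^ q)%:E))).
  apply: leeD => //.
  rewrite ge0_integral_sum//; last by move=> p; exact: emeasurable_funM.
  apply: (@le_trans _ _ (\int[mu]_x
      \sum_(p <- enum {: K * 'I_D}) (w p.2)%:E * (\1_(Om p.2) x)%:E)).
    rewrite ge0_integral_sum//; last 2 first.
      by move=> p; exact: emeasurable_funM.
      by move=> p x _; rewrite mule_ge0 ?lee_fin.
    apply: lee_sum => -[k l] _ /=.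
    rewrite !ge0_integralZl ?lee_fin//; last by move=> x _; rewrite lee_fin.
    rewrite lee_wpmul2l ?lee_fin// integral_indic// setIT.
    apply: integral_exp_depth_sparse (tower k) _ _ => // j.
    exact: SOm.
  apply: ge0_le_integral => //.
  - by move=> x _; apply: sume_ge0 => p _; rewrite mule_ge0 ?lee_fin.
  - by apply: emeasurable_sum => p; exact: emeasurable_funM.
  - exact: emeasurable_funM.
  move=> x _; rewrite big_enum/= -EFinM.
  under eq_bigr do rewrite -EFinM.
  rewrite sumEFin lee_fin.
  rewrite -(pair_bigA _ (fun k (l : 'I_D) => w l * \1_(Om l) x)%R)/=.
  rewrite sumr_const.
  have -> : (\sum_(l < D) w l * \1_(Om l) x =
      c / N%:R * \sum_(l < D | b / 2 ^+ l < 2 * V x) (b / 2 ^+ l) `^ q)%R.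
    rewrite [in RHS]big_mkcond mulr_sumr; apply: eq_bigr => l _.
    rewrite indicE /Om; case: ifPn => [h|/negP h].
      by rewrite mem_set// mulr1.
    by rewrite memNset// !mulr0.
  have := sum_geometric_below D q1 b0 (mulr_ge0 (ler0n R 2) (V0 x)).
  set Z := (\sum_(l < D | _) _)%R => HZ.
  apply: (@le_trans _ _ ((d%:R * N%:R) * (c / N%:R * Z))%R).
    rewrite -[leLHS]mulr_natl -natrM ler_wpM2r ?ler_nat//.
    rewrite !mulr_ge0 ?invr_ge0 ?(ltW c0)//.
    by apply: sumr_ge0 => l _; exact: powR_ge0.
  rewrite (_ : _ * _ = d%:R * c * Z)%R; last by field; rewrite pnatr_eq0 -lt0n.
  rewrite -!mulrA ler_wpM2l// ler_wpM2l ?(ltW c0)//.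
  by rewrite powRM// in HZ.
rewrite ge0_integralZl//; last 2 first.
- by move=> x _; rewrite lee_fin powR_ge0.
- by rewrite lee_fin !mulr_ge0 ?powR_ge0// ltW.
rewrite -ge0_muleDl ?lee_fin//; last by rewrite !mulr_ge0 ?powR_ge0// ltW.
rewrite lee_wpmul2r//; first by apply: integral_ge0 => x _; rewrite lee_fin powR_ge0.
rewrite -EFinD lee_fin !powRM ?powR_ge0 ?(ltW c0) ?(le_trans ler01 L1)//.
rewrite -[X in (_ <= X * _)%R]powRrM mulVf ?gt_eqF// powRr1 ?(ltW c2p)//.
rewrite /c2 [leRHS]mulrDl lerD2l ler_peMr ?mulr_ge0 ?powR_ge0 ?(ltW c0)//.
have <- : (1 `^ q = 1 :> R)%R by rewrite powR1.
by rewrite ge0_ler_powR ?nnegrE ?(ltW q0)// (le_trans _ L1).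
Qed.
End finite_bounds.

(** * The weak bound for finite families *)

Section finite_weak_bound.
Context {R : realType}.

Lemma markov_powR {disp} {T : measurableType disp}
    (mu : {measure set T -> \bar R}) (f : T -> R) (q l : R) :
  measurable_fun setT f -> (0 <= q)%R -> (0 < l)%R ->
  (l `^ q)%:E * mu [set x | l < f x]%R <= \int[mu]_x (f x `^ q)%:E.
Proof.
move=> mf q0 l0; have mA := measurable_superlevel l mf.
set A := [set x | _] in mA *.
have m1 : measurable_fun setT (fun x => (\1_A x : R)%:E).
  by apply/measurable_EFinP; exact: measurable_indic.
have -> : mu A = \int[mu]_x (\1_A x)%:E by rewrite integral_indic// setIT.
rewrite -ge0_integralZl//; last by rewrite lee_fin powR_ge0.
apply: ge0_le_integral => //.
- by move=> x _; rewrite mule_ge0 ?lee_fin ?powR_ge0.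
- exact: emeasurable_funM.
- by apply/measurable_EFinP; exact: (measurableT_comp (measurable_powR _)).
move=> x _; rewrite -EFinM lee_fin indicE.
have [/set_mem lf|_] := boolP (x \in A); last by rewrite mulr0 powR_ge0.
rewrite mulr1 ge0_ler_powR ?nnegrE ?(ltW l0)//; last exact: ltW.
by apply: ltW; exact: lt_trans lf.
Qed.

(** The layers s / 2 ^ (j+1) < V contribute a convergent geometric series,
    because the exponent of the integral exceeds that of the weak bound. *)
Lemma integral_minr_powR_le {disp} {T : measurableType disp}
    (mu : {measure set T -> \bar R}) (V : T -> R) (p s H : R) :
  (1 <= p)%R -> (0 < s)%R -> (0 <= H)%R ->
  measurable_fun setT V -> (forall x, 0 <= V x)%R ->
  (forall t : R, (0 < t)%R -> mu [set x | t < V x]%R <= ((H / t) `^ p)%:E) ->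
  \int[mu]_x (Num.min (V x) s `^ (p + 1))%:E <= (2 * s * (2 * H) `^ p)%:E.
Proof.
move=> p1 s0 H0 mV V0 VH; have p0 : (0 < p)%R by exact: lt_le_trans p1.
have u0 (j : nat) : (0 < s / 2 ^+ j)%R by rewrite divr_gt0// exprn_gt0.
pose A (j : nat) := [set x | s / 2 ^+ j / 2 < V x]%R.
have mA j : measurable (A j) by exact: measurable_superlevel.
have m1 j : measurable_fun setT (fun x => (\1_(A j) x : R)%:E).
  by apply/measurable_EFinP; exact: measurable_indic.
pose h (j : nat) x := ((s / 2 ^+ j) `^ (p + 1))%:E * (\1_(A j) x : R)%:E.
have h0 j x : 0 <= h j x by rewrite mule_ge0 ?lee_fin ?powR_ge0.
have mh j : measurable_fun setT (h j) by exact: emeasurable_funM.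
apply: (@le_trans _ _ (\int[mu]_x \sum_(0 <= j <oo) h j x)).
  apply: ge0_le_integral => //.
  - by move=> x _; rewrite lee_fin powR_ge0.
  - apply/measurable_EFinP; apply: (measurableT_comp (measurable_powR _)).
    exact: measurable_minr.
  - by apply: ge0_emeasurable_sum => // j x _ _; exact: h0.
  move=> x _; have [Vx|Vx] := ltP 0%R (V x); last first.
    have -> : V x = 0%R by apply/eqP; rewrite eq_le Vx V0.
    rewrite minEle (ltW s0) powR0; last by rewrite gt_eqF// addr_gt0.
    by apply: nneseries_ge0 => j _ _.
  have m0 : (0 < Num.min (V x) s)%R by rewrite lt_min Vx s0.
  have ms : (Num.min (V x) s <= s)%R by rewrite ge_min lexx orbT.
  have [l [l1 l2]] := dyadic_level m0 ms.
  apply: (@le_trans _ _ (h l x)).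
    rewrite /h indicE mem_set; last first.
      rewrite /A/= ltr_pdivrMr// [ltRHS]mulrC; apply: (lt_le_trans l1).
      by rewrite ler_pM2l// ge_min lexx.
    rewrite mule1 lee_fin; apply: ge0_ler_powR => //.
    - by rewrite addr_ge0// ltW.
    - by rewrite nnegrE ltW.
    - by rewrite nnegrE ltW.
  apply: le_trans (nneseries_lim_ge l.+1 _); last by move=> *; exact: h0.
  by rewrite big_nat_recr//= leeDr// sume_ge0.
rewrite integral_nneseries//.
apply: lime_le; first by apply: is_cvg_nneseries => j _ _; exact: integral_ge0.
apply: nearW => n.
have hj j : \int[mu]_x h j x <= (s * (2 * H) `^ p * 2^-1 ^+ j)%:E.
  rewrite /h ge0_integralZl ?lee_fin ?powR_ge0//.
  rewrite integral_indic// setIT.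
  apply: (@le_trans _ _ (((s / 2 ^+ j) `^ (p + 1))%:E *
      ((H / (s / 2 ^+ j / 2)) `^ p)%:E)).
    by rewrite lee_wpmul2l ?lee_fin ?powR_ge0//; apply: VH; rewrite divr_gt0.
  rewrite -EFinM lee_fin powRD; last by rewrite (gt_eqF (u0 j)) implybT.
  rewrite powRr1 ?(ltW (u0 j))// mulrAC -powRM ?(ltW (u0 j))//; last first.
    by rewrite divr_ge0// ltW// divr_gt0.
  rewrite (_ : s / 2 ^+ j * (H / (s / 2 ^+ j / 2)) = 2 * H)%R; last first.
    by field; rewrite expf_neq0//= gt_eqF.
  by rewrite mulrC mulrAC exprVn.
apply: (@le_trans _ _ (\sum_(0 <= j < n) (s * (2 * H) `^ p * 2^-1 ^+ j)%:E)).
  by apply: lee_sum => j _.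
rewrite sumEFin lee_fin -mulr_sumr big_mkord.
have := @sum_geometric_tail R 2^-1 0 n; rewrite expr0 => geo.
have {}geo : (\sum_(i < n) 2^-1 ^+ i <= 2 :> R)%R.
  apply: le_trans (geo _) _; first by apply/andP; split; lra.
  by rewrite (_ : 1 - 2^-1 = 2^-1)%R ?invrK ?mul1r//; lra.
have := powR_ge0 (2 * H) p; set X := (_ `^ p)%R => X0.
have sX : (0 <= s * X)%R by rewrite mulr_ge0 ?(ltW s0).
by nra.
Qed.

(** Above the level s = l / log_+ N the weak bound for V is used directly;
    below it only the coefficients at most s matter, and there the strong bound
    with exponent p + 1 applies to the truncation of V at s. *)
Lemma max_step_sum_weak (gamma C : R) (d : nat) (p : R) :
  (0 < gamma)%R -> (0 < C)%R -> (1 <= p)%R ->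
  exists2 c : R, (0 < c)%R &
    forall (disp : measure_display) (T : measurableType disp)
      (mu : {measure set T -> \bar R}) (K J : finType) (N : nat)
      (S B E : K -> J -> set T) (al : K -> J -> R) (V : T -> R) (H l : R),
    (1 <= N)%N -> (#|K| <= d * N)%N ->
    (forall k, sparse_tower mu gamma C (S k) (B k) (E k)) ->
    (forall k j, 0 <= al k j)%R ->
    measurable_fun setT V -> (forall x, 0 <= V x)%R ->
    (forall k j x, S k j x -> al k j <= V x)%R ->
    (0 <= H)%R ->
    (forall t : R, (0 < t)%R -> mu [set x | t < V x]%R <= ((H / t) `^ p)%:E) ->
    (0 < l)%R ->
    mu [set x | l < max_step_sum S al x]%R <=
      ((c * log_plus R N * H / l) `^ p)%:E.
Proof.
move=> g0 C0 p1; have p0 : (0 < p)%R by exact: lt_le_trans p1.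
have q1 : (1 <= p + 1)%R by rewrite lerDr ltW.
have [c c0 cP] := max_step_sum_strong d g0 C0 q1.
pose c2 := (1 + c `^ (p + 1) * (2 * 2 `^ p))%R.
have c2p : (0 < c2)%R by rewrite ltr_wpDr// !mulr_ge0 ?powR_ge0.
exists (c2 `^ p^-1)%R; first exact: powR_gt0.
move=> disp T mu K J N S B E al V H l N1 KN tower al0 mV V0 alV H0 VH l0.
set L := log_plus R N; have L1 : (1 <= L)%R by exact: log_plus_ge1.
have L0 : (0 < L)%R by exact: lt_le_trans L1.
have mS k j : measurable (S k j) by case: (tower_measurable (tower k) j).
pose s := (l / L)%R; have s0 : (0 < s)%R by exact: divr_gt0.
pose al' k j := if (al k j <= s)%R then al k j else 0%R.
have al'0 k j : (0 <= al' k j)%R by rewrite /al'; case: ifP.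
pose V' x := Num.min (V x) s.
have mV' : measurable_fun setT V' by exact: measurable_minr.
have V'0 x : (0 <= V' x)%R by rewrite le_min V0 ltW.
have alV' k j x : S k j x -> (al' k j <= V' x)%R.
  move=> Sx; rewrite /al' le_min; case: ifPn => [als|_].
    by rewrite als alV.
  by rewrite V0 ltW.
have sub : [set x | l < max_step_sum S al x]%R `<=`
    [set x | s < V x]%R `|` [set x | l < max_step_sum S al' x]%R.
  move=> x /= lG; have [Vs|] := leP (V x) s; last by left.
  right; suff <- : max_step_sum S al x = max_step_sum S al' x by [].
  rewrite /max_step_sum; apply: eq_bigr => k _; apply: eq_bigr => j _.
  rewrite indicE; have [/set_mem Sx|_] := boolP (x \in S k j); last first.
    by rewrite !mulr0.
  by rewrite /al' (le_trans _ Vs)// alV.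
have mG (a : K -> J -> R) : measurable_fun setT (max_step_sum S a).
  exact: measurable_max_step_sum.
have mA1 := measurable_superlevel l (mG al).
have mA2 := measurable_superlevel l (mG al').
have mA3 := measurable_superlevel s mV.
apply: (@le_trans _ _ (mu [set x | s < V x]%R +
    mu [set x | l < max_step_sum S al' x]%R)).
  apply: le_trans (measureU2 mu mA3 mA2).
  by apply: le_measure; rewrite ?inE//; exact: measurableU.
have tail : mu [set x | l < max_step_sum S al' x]%R <=
    (c `^ (p + 1) * (2 * 2 `^ p) * (L * H / l) `^ p)%:E.
  have lq : (0 < l `^ (p + 1))%R by exact: powR_gt0.
  rewrite -(@lee_pmul2l _ (l `^ (p + 1))%:E)//.
  apply: (le_trans (markov_powR mu (mG al') _ l0)); first by rewrite (le_trans ler01).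
  apply: (le_trans (cP _ _ _ _ _ _ _ _ _ _ V' N1 KN tower al'0 mV' V'0 alV')).
  apply: (@le_trans _ _ (((c * L) `^ (p + 1))%:E * (2 * s * (2 * H) `^ p)%:E)).
    rewrite lee_wpmul2l ?lee_fin ?powR_ge0//.
    exact: integral_minr_powR_le.
  rewrite -!EFinM lee_fin /s.
  have powS (y : R) : (0 < y -> y `^ (p + 1) = y `^ p * y)%R.
    move=> y0; rewrite powRD ?powRr1 ?(ltW y0)//.
    by rewrite (gt_eqF y0) implybT.
  have lE : (l `^ p * (L * H / l) `^ p = L `^ p * H `^ p)%R.
    rewrite -!powRM ?(ltW L0) ?(ltW l0)//; last by rewrite divr_ge0 ?mulr_ge0// ltW.
    by congr (_ `^ _)%R; field; rewrite gt_eqF.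
  rewrite (powS l)// [leRHS](_ : _ =
      c `^ (p + 1) * (2 * 2 `^ p) * (l `^ p * (L * H / l) `^ p) * l)%R; last by ring.
  rewrite lE [((c * L) `^ _)%R]powRM ?(ltW c0) ?(ltW L0)// (powS L)//.
  rewrite [((2 * H) `^ _)%R]powRM// le_eqVlt; apply/orP; left; apply/eqP.
  by field; rewrite gt_eqF.
apply: (le_trans (leeD (VH _ s0) tail)).
rewrite -EFinD lee_fin.
have -> : (H / s = L * H / l)%R by rewrite /s; field; rewrite !gt_eqF.
have -> : (c2 `^ p^-1 * L * H / l = c2 `^ p^-1 * (L * H / l))%R by ring.
rewrite [leRHS]powRM ?powR_ge0//; last first.
  by rewrite divr_ge0 ?mulr_ge0// ltW.
rewrite -[X in (_ <= X * _)%R]powRrM mulVf ?gt_eqF// powRr1 ?(ltW c2p)//.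
by rewrite /c2 [leRHS]mulrDl mul1r.
Qed.
End finite_weak_bound.

(** * Countability *)

Section countability.
Context {disp : measure_display} {T : measurableType disp} {R : realType}.
Variable mu : {measure set T -> \bar R}.

(** The choices hidden in the definition of a finite-martingale sparse
    collection: E S is the distinguished part of S, B S a covering set, and
    [lev S] the martingale collection that B S comes from. *)
Record tower_choice (gamma C : R) (d : nat) (SS : set (set T))
    (E B : set T -> set T) (lev : set T -> nat) : Prop := TowerChoice {
  choice_averageable : averageable mu SS;
  choice_measurable : forall S, SS S -> measurable (B S) /\ measurable (E S);
  choice_sub : forall S, SS S -> E S `<=` S /\ S `<=` B S;
  choice_sparse : forall S, SS S -> gamma%:E * mu S <= mu (E S);
  choice_cover : forall S, SS S -> mu (B S) <= C%:E * mu S;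
  choice_disjoint : trivIset SS E;
  choice_lev : forall S, SS S -> (lev S < d)%N;
  choice_laminar : forall S S', SS S -> SS S' -> lev S = lev S' ->
    [\/ B S `<=` B S', B S' `<=` B S | B S `&` B S' = set0] }.

Lemma tower_choice_exists (gamma C C' : R) (d : nat) (SS : set (set T)) :
  (C <= C')%R -> finite_martingale_sparse mu gamma d C SS ->
  exists E B lev, tower_choice gamma C' d SS E B lev.
Proof.
move=> CC' [av [E [Esub Etriv]] [BBk [BBkM BBkC]]].
have /choice[f fP] : forall S, exists p : nat * set T, SS S ->
    exists2 k : 'I_d, nat_of_ord k = p.1 &
      [/\ BBk k p.2, S `<=` p.2 & mu p.2 <= C%:E * mu S].
  move=> S; have [SSS|nS] := pselect (SS S); last by exists (0%N, set0).
  by have [k [B' BP]] := BBkC S SSS; exists (nat_of_ord k, B') => _; exists k.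
exists E, (snd \o f), (fst \o f); split => //=.
- move=> S SSS; have [k _ [kB _ _]] := fP S SSS.
  by split; [exact: (BBkM k).1|case: (Esub S SSS)].
- move=> S SSS; have [k _ [_ SB _]] := fP S SSS.
  by split=> //; case: (Esub S SSS).
- by move=> S /Esub[].
- move=> S SSS; have [k _ [_ _ cov]] := fP S SSS.
  by apply: (le_trans cov); rewrite lee_wpmul2r ?lee_fin.
- by move=> S SSS; have [k <- _] := fP S SSS.
- move=> S S' SSS SSS'; have [k <- [kB _ _]] := fP S SSS.
  have [k' <- [kB' _ _]] := fP S' SSS' => /ord_inj kk'.
  by apply: (BBkM k).2 => //; rewrite kk'.
Qed.

(** The members of level l, in the given indexing; the other indices get the
    empty set, so that one enumeration serves all levels. *)
Definition pick_level (J : Type) (SS : set (set T)) (lev : set T -> nat)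
    (l : nat) (u : J -> set T) (F : set T -> set T) (j : J) : set T :=
  if `[< SS (u j) /\ lev (u j) = l >] then F (u j) else set0.

Lemma tower_choice_pick (gamma C : R) d SS E B lev (J : Type) (u : J -> set T) l :
  tower_choice gamma C d SS E B lev ->
  (forall i j, SS (u i) -> u i = u j -> i = j) ->
  sparse_tower mu gamma C (pick_level SS lev l u id)
    (pick_level SS lev l u B) (pick_level SS lev l u E).
Proof.
move=> [av meas sub sp cov triv _ lam] uinj; split.
- move=> j; rewrite /pick_level; case: asboolP => [[Sj _]|_] //.
  by have [] := meas _ Sj; have [] := av _ Sj.
- by move=> j; rewrite /pick_level; case: asboolP => [[Sj _]|_]; [exact: sub|split => x].
- move=> j; rewrite /pick_level; case: asboolP => [[Sj _]|_]; first exact: sp.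
  by rewrite measure0 mule0.
- move=> j; rewrite /pick_level; case: asboolP => [[Sj _]|_]; first exact: cov.
  by rewrite measure0 mule0.
- move=> i j _ _; rewrite /pick_level.
  case: asboolP => [[Si _]|_]; last by rewrite set0I => -[].
  case: asboolP => [[Sj _]|_]; last by rewrite setI0 => -[].
  by move=> /(triv _ _ Si Sj); exact: uinj.
- move=> i j; rewrite /pick_level.
  case: asboolP => [[Si li]|_]; last by constructor 1 => x.
  case: asboolP => [[Sj lj]|_]; last by constructor 2 => x.
  by apply: lam => //; rewrite li lj.
Qed.

Lemma sum_integral_le_depth (J : finType) (S : J -> set T) (h : T -> \bar R)
    (D : R) :
  (0 <= D)%R -> (forall j, measurable (S j)) ->
  measurable_fun setT h -> (forall x, 0 <= h x) ->
  (forall x, (depth S [set: J]%SET x)%:R <= D)%R ->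
  \sum_j \int[mu]_(x in S j) h x <= D%:E * \int[mu]_x h x.
Proof.
move=> D0 mS mh h0 SD.
have mS1 j : measurable_fun setT (fun x => h x * (\1_(S j) x : R)%:E).
  by apply: emeasurable_funM => //; apply/measurable_EFinP; exact: measurable_indic.
have hS0 j x : 0 <= h x * (\1_(S j) x : R)%:E by rewrite mule_ge0 ?lee_fin.
rewrite -ge0_integralZl ?lee_fin//.
rewrite (eq_bigr (fun j => \int[mu]_x (h x * (\1_(S j) x)%:E))); last first.
  by move=> j _; rewrite integral_mkcond epatch_indic.
rewrite -big_enum/= -ge0_integral_sum//; apply: ge0_le_integral => //.
- by move=> x _; apply: sume_ge0 => j _.
- exact: emeasurable_sum.
- exact: emeasurable_funM.
move=> x _; rewrite big_enum/= -ge0_sume_distrr; last by move=> j _; rewrite lee_fin.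
rewrite sumEFin muleC lee_wpmul2r// lee_fin; apply: le_trans (SD x).
rewrite depth_sum; under [leRHS]eq_bigl do rewrite inE.
by [].
Qed.

(** The covering sets through a point form a chain, and its largest member, of
    measure at most C M, has room for at most C M^2 / gamma disjoint sets E j of
    measure at least gamma / M. *)
Lemma tower_depth_le (gamma C M : R) (J : finType) (S B E : J -> set T) x :
  (0 < gamma)%R -> (0 < C)%R -> (0 < M)%R -> sparse_tower mu gamma C S B E ->
  (forall j, (M^-1)%:E <= mu (S j) <= M%:E) ->
  ((depth S [set: J]%SET x)%:R <= C * M ^+ 2 / gamma)%R.
Proof.
move=> g0 C0 M0 [mSBE sub sp cov triv lam] SM.
pose F := [set j in [set: J]%SET | x \in S j]; rewrite /depth -/F.
have [->|F0] := eqVneq F finset.set0.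
  by rewrite cards0 !mulr_ge0 ?exprn_ge0 ?invr_ge0// ltW.
have [i iF imax] := laminar_maximal lam F0.
have xB j : j \in F -> B j x.
  by rewrite inE => /andP[_ /set_mem]; exact: (sub j).2.
have : \sum_(j in F) mu (E j) <= mu (B i).
  apply: sum_measure_disjoint_le => // [j||j jF].
  - by case: (mSBE j).
  - by case: (mSBE i).
  apply: subset_trans (subset_trans (sub j).1 (sub j).2) _.
  by apply: imax => //; exists x; split; exact: xB.
move=> EB.
have : \sum_(j in F) (gamma / M)%:E <= (C * M)%:E.
  apply: (@le_trans _ _ (\sum_(j in F) mu (E j))).
    apply: lee_sum => j _; apply: le_trans (sp j).
    by rewrite EFinM lee_wpmul2l ?lee_fin ?(ltW g0)//; case/andP: (SM j).
  apply: (le_trans EB); apply: (le_trans (cov i)).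
  by rewrite EFinM lee_wpmul2l ?lee_fin ?(ltW C0)//; case/andP: (SM i).
rewrite sumEFin sumr_const lee_fin -[leLHS]mulr_natr => H.
rewrite ler_pdivlMr//; have := ler_wpM2r (ltW M0) H.
rewrite (_ : _ / M * _ * M = #|F|%:R * gamma)%R; last by field; rewrite gt_eqF.
by rewrite expr2 mulrA.
Qed.

(** At a fixed level, among the sets whose measure and charge lie within fixed
    positive bounds there are only finitely many: n of them have total charge at
    least a multiple of n, but overlap boundedly, so this total is at most a
    multiple of the integral of h. *)
Lemma countable_charged (gamma C : R) d (SS : set (set T)) (h : T -> \bar R) :
  (0 < gamma)%R -> finite_martingale_sparse mu gamma d C SS ->
  measurable_fun setT h -> (forall x, 0 <= h x) -> \int[mu]_x h x < +oo ->
  countable [set S | SS S /\ 0 < \int[mu]_(x in S) h x].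
Proof.
move=> g0 fms mh h0 hfin.
pose C' : R := Num.max C 1%R; have C'0 : (0 < C')%R by rewrite lt_max ltr01 orbT.
have CC' : (C <= C')%R by rewrite le_max lexx.
have [E [B [lev tc]]] := tower_choice_exists CC' fms.
pose A (p : nat * nat) := [set S | [/\ SS S, lev S = p.1,
  (p.2.+1%:R^-1)%:E <= mu S <= p.2.+1%:R%:E &
  (p.2.+1%:R^-1)%:E <= \int[mu]_(x in S) h x]].
apply: (@sub_countable _ _ _ (\bigcup_(p in [set: nat * nat]) A p)); last first.
  apply: bigcup_countable => // p _; apply: finite_set_countable.
  apply: contrapT => /infiniteP/pcard_leP[f].
  have fA n : A p (f n) by exact: funS.
  have finj : injective f by move=> i j; apply: inj; rewrite inE.
  set M : R := p.2.+1%:R; have M0 : (0 < M)%R by rewrite ltr0n.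
  pose I := fine (\int[mu]_x h x).
  have I0 : 0 <= \int[mu]_x h x by exact: integral_ge0.
  have IE : \int[mu]_x h x = I%:E by rewrite /I fineK// ge0_fin_numE.
  pose K := (C' * M ^+ 2 / gamma)%R.
  have K0 : (0 <= K)%R by rewrite !mulr_ge0 ?exprn_ge0 ?invr_ge0// ltW.
  pose n := Num.bound (M * (K * I))%R.
  pose u (i : 'I_n) := f i.
  have uinj i j : SS (u i) -> u i = u j -> i = j by move=> _ /finj/ord_inj.
  have tower := tower_choice_pick p.1 tc uinj.
  have pickE : pick_level SS lev p.1 u id = u.
    apply/funext => i; rewrite /pick_level; case: asboolP => //.
    by case: (fA i) => ? ? _ _ [].
  rewrite pickE in tower.
  have dK x : ((depth u [set: 'I_n]%SET x)%:R <= K)%R.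
    by apply: tower_depth_le tower _ => // j; case: (fA j).
  have mu_ j : measurable (u j) by case: (tower_measurable tower j).
  have := sum_integral_le_depth K0 mu_ mh h0 dK; rewrite leNgt => /negP; apply.
  rewrite IE -EFinM; apply: (@lt_le_trans _ _ (\sum_(j < n) (M^-1)%:E)).
    rewrite sumEFin lte_fin sumr_const card_ord -mulr_natr ltr_pdivlMl//.
    apply: archi_boundP; apply: mulr_ge0; first exact: ltW.
    by apply: mulr_ge0 => //; exact: fine_ge0.
  by apply: lee_sum => j _; case: (fA j).
apply: subset_card_le => S [SSS S0].
have [mS /andP[mS0 mSoo]] := choice_averageable tc SSS.
have Ioo : \int[mu]_(x in S) h x < +oo.
  by apply: le_lt_trans hfin; apply: ge0_subset_integral.
pose r := fine (mu S); pose s := fine (\int[mu]_(x in S) h x).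
have rE : mu S = r%:E by rewrite fineK// ge0_fin_numE// ltW.
have sE : \int[mu]_(x in S) h x = s%:E.
  by rewrite fineK// ge0_fin_numE// ltW.
have r0 : (0 < r)%R by rewrite -lte_fin -rE.
have s0 : (0 < s)%R by rewrite -lte_fin -sE.
pose m := Num.bound (r + r^-1 + s^-1)%R.
have mP : (r + r^-1 + s^-1 < m.+1%:R)%R.
  apply: (lt_trans (archi_boundP _)); last by rewrite ltr_nat.
  by rewrite !addr_ge0 ?invr_ge0// ltW.
have ri : (0 < r^-1)%R by rewrite invr_gt0.
have si : (0 < s^-1)%R by rewrite invr_gt0.
exists (lev S, m) => //; split => //=.
  rewrite rE !lee_fin; apply/andP; split; last by lra.
  by rewrite invf_ple ?posrE ?ltr0n//; lra.
by rewrite sE lee_fin invf_ple ?posrE ?ltr0n//; lra.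
Qed.

End countability.

(** * Increasing limits *)

(** How both operators arise from finite subfamilies. A measure is unspecified on
    sets that are not measurable, so superlevel sets have to be reached through
    such a sequence. *)
Record exhausts {disp} {T : measurableType disp} {R : realType}
    (g : nat -> T -> R) (F : T -> \bar R) : Prop := Exhausts {
  exhausts_measurable : forall n, measurable_fun setT (g n);
  exhausts_ge0 : forall n x, (0 <= g n x)%R;
  exhausts_nd : forall x, {homo g ^~ x : n m / (n <= m)%N >-> (n <= m)%R};
  exhausts_sup : forall x, F x = ereal_sup (range (fun n => (g n x)%:E)) }.

Section monotone_limits.
Context {disp : measure_display} {T : measurableType disp} {R : realType}.
Variable mu : {measure set T -> \bar R}.
Variables (g : nat -> T -> R) (F : T -> \bar R).
Hypothesis gF : exhausts g F.

Let mg := exhausts_measurable gF.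
Let g0 := exhausts_ge0 gF.
Let g_nd := exhausts_nd gF.
Let FE := exhausts_sup gF.

Lemma sup_ge n x : (g n x)%:E <= F x.
Proof. by rewrite FE; apply: ereal_sup_ubound; exists n. Qed.

Lemma sup_ge0 x : 0 <= F x.
Proof. by apply: le_trans (sup_ge 0 x); rewrite lee_fin. Qed.

Lemma sup_superlevel (t : R) :
  [set x | t%:E < `|F x|] = \bigcup_n [set x | t < g n x]%R.
Proof.
apply/seteqP; split => x /=; rewrite gee0_abs ?sup_ge0//.
  rewrite FE => /ereal_sup_gtP[_ [n _ <-] /=]; rewrite lte_fin => tg.
  by exists n.
by move=> [n _ /= tg]; apply: lt_le_trans (sup_ge n x); rewrite lte_fin.
Qed.

Lemma measurable_sup_superlevel (t : R) : measurable [set x | t%:E < `|F x|].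
Proof.
rewrite sup_superlevel; apply: bigcup_measurable => n _.
exact: measurable_superlevel.
Qed.

Lemma superlevel_le_sup (t : R) n :
  mu [set x | t < g n x]%R <= mu [set x | t%:E < `|F x|].
Proof.
apply: le_measure; rewrite ?inE; first exact: measurable_superlevel.
  exact: measurable_sup_superlevel.
by rewrite sup_superlevel => x tg; exists n.
Qed.

Lemma sup_superlevel_le (t : R) (b : \bar R) :
  (forall n, mu [set x | t < g n x]%R <= b) -> mu [set x | t%:E < `|F x|] <= b.
Proof.
move=> gb; rewrite sup_superlevel.
have mG n : measurable [set x | t < g n x]%R by exact: measurable_superlevel.
have mU : measurable (\bigcup_n [set x | t < g n x]%R).
  by apply: bigcup_measurable => n _.
have nd : {homo (fun n => [set x | t < g n x]%R) : n m / (n <= m)%N >-> (n <= m)%O}.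
  move=> n m nm; apply/subsetPset => x /= tg; apply: lt_le_trans tg _.
  exact: g_nd.
have cv := @nondecreasing_cvg_mu _ _ _ mu _ mG mU nd.
rewrite -(cvg_lim _ cv)//; apply: lime_le.
  by apply/cvg_ex; exists (mu (\bigcup_n [set x | t < g n x]%R)).
exact: nearW.
Qed.

Lemma sup_cvg x : (g n x)%:E @[n --> \oo] --> F x.
Proof.
by rewrite FE; apply: ereal_nondecreasing_cvgn => n m nm; rewrite lee_fin g_nd.
Qed.

Lemma measurable_sup : measurable_fun setT F.
Proof.
apply: (emeasurable_fun_cvg (fun n x => (g n x)%:E)) => [n|x _].
  exact/measurable_EFinP.
exact: sup_cvg.
Qed.

Lemma measurable_sup_poweR (q : R) : measurable_fun setT (fun x => `|F x| `^ q).
Proof.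
apply: (measurableT_comp (measurable_poweR q)).
by apply: measurableT_comp => //; exact: measurable_sup.
Qed.

Lemma integral_powR_le_sup (q : R) n : (0 < q)%R ->
  \int[mu]_x (g n x `^ q)%:E <= \int[mu]_x `|F x| `^ q.
Proof.
move=> q0; apply: ge0_le_integral => //.
- by move=> x _; rewrite lee_fin powR_ge0.
- by apply/measurable_EFinP; exact: (measurableT_comp (measurable_powR _)).
- exact: measurable_sup_poweR.
move=> x _; rewrite -poweR_EFin gee0_abs ?sup_ge0//.
apply: gt0_ler_poweR; first exact: ltW.
- by rewrite in_itv/= lee_fin g0 leey.
- by rewrite in_itv/= sup_ge0 leey.
- exact: sup_ge.
Qed.

Lemma sup_integral_powR_le (q : R) (b : \bar R) : (0 < q)%R ->
  (forall n, \int[mu]_x (g n x `^ q)%:E <= b) -> \int[mu]_x `|F x| `^ q <= b.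
Proof.
move=> q0 gb.
have mgq n : measurable_fun setT (fun x => (g n x `^ q)%:E).
  by apply/measurable_EFinP; exact: (measurableT_comp (measurable_powR _)).
have gq0 n x : [set: T] x -> 0 <= (g n x `^ q)%:E by rewrite lee_fin powR_ge0.
have ndq x : {homo (fun n => (g n x `^ q)%:E) : n m / (n <= m)%N >-> n <= m}.
  move=> n m nm; rewrite lee_fin ge0_ler_powR ?nnegrE ?(ltW q0)//.
  exact: g_nd.
have FqE x : `|F x| `^ q = limn (fun n => (g n x `^ q)%:E).
  have -> : limn (fun n => (g n x `^ q)%:E) =
      ereal_sup (range (fun n => (g n x `^ q)%:E)).
    by apply: cvg_lim => //; exact: ereal_nondecreasing_cvgn.
  rewrite gee0_abs ?sup_ge0//; apply/eqP; rewrite eq_le; apply/andP; split.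
    set s := ereal_sup _.
    have s0 : 0 <= s.
      by apply: (@le_trans _ _ (g 0 x `^ q)%:E); [rewrite lee_fin powR_ge0|
        apply: ereal_sup_ubound; exists 0%N].
    have -> : s = (s `^ q^-1) `^ q by rewrite -poweRrM mulVf ?gt_eqF// poweRe1.
    apply: gt0_ler_poweR; first exact: ltW.
    - by rewrite in_itv/= sup_ge0 leey.
    - by rewrite in_itv/= poweR_ge0 leey.
    rewrite FE; apply: ge_ereal_sup => _ [n _ <-].
    have -> : (g n x)%:E = ((g n x `^ q)%:E) `^ q^-1.
      by rewrite -poweR_EFin -poweRrM mulfV ?gt_eqF// poweRe1// lee_fin.
    apply: gt0_ler_poweR; first by rewrite invr_ge0 ltW.
    - by rewrite in_itv/= lee_fin powR_ge0 leey.
    - by rewrite in_itv/= s0 leey.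
    - by apply: ereal_sup_ubound; exists n.
  apply: ge_ereal_sup => _ [n _ <-]; rewrite -poweR_EFin.
  apply: gt0_ler_poweR; first exact: ltW.
  - by rewrite in_itv/= lee_fin g0 leey.
  - by rewrite in_itv/= sup_ge0 leey.
  - exact: sup_ge.
under eq_integral do rewrite FqE.
rewrite (monotone_convergence mu measurableT mgq gq0)//.
apply: lime_le; last exact: nearW.
apply: ereal_nondecreasing_is_cvgn => n m nm; apply: ge0_le_integral => //.
  by move=> x; exact: gq0.
by move=> x _; exact: ndq.
Qed.

End monotone_limits.

Section norm_conversions.
Context {disp : measure_display} {T : measurableType disp} {R : realType}.
Variable mu : {measure set T -> \bar R}.

Lemma weak_Lnorm_leP (p H : R) (F : T -> \bar R) : (0 < p)%R -> (0 <= H)%R ->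
  weak_Lnorm mu p F <= H%:E <->
  (forall t : R, (0 < t)%R -> mu [set x | t%:E < `|F x|] <= ((H / t) `^ p)%:E).
Proof.
move=> p0 H0; split=> [FH t t0|FH].
  set m := mu _.
  have : t%:E * m `^ p^-1 <= H%:E.
    by apply: le_trans FH; apply: ereal_sup_ubound; exists t.
  rewrite muleC -lee_pdivlMr// => mH.
  have -> : m = (m `^ p^-1) `^ p by rewrite -poweRrM mulVf ?gt_eqF// poweRe1// measure_ge0.
  rewrite -poweR_EFin; apply: gt0_ler_poweR; first exact: ltW.
  - by rewrite in_itv/= poweR_ge0 leey.
  - by rewrite in_itv/= lee_fin divr_ge0 ?(ltW t0)// leey.
  - by rewrite EFinM.
apply: ge_ereal_sup => _ [t /= t0 <-]; set m := mu _.
rewrite muleC -lee_pdivlMr//.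
have -> : H%:E * (t^-1)%:E = (((H / t) `^ p)%:E) `^ p^-1.
  rewrite -poweR_EFin -poweRrM mulfV ?gt_eqF// poweRe1 ?EFinM//.
  by rewrite lee_fin divr_ge0// ltW.
apply: gt0_ler_poweR; first by rewrite invr_ge0 ltW.
- by rewrite in_itv/= leey andbT; exact: measure_ge0.
- by rewrite in_itv/= lee_fin powR_ge0 leey.
- exact: FH.
Qed.

Lemma Lnorm_leP (p H : R) (F : T -> \bar R) : (0 < p)%R -> (0 <= H)%R ->
  'N[mu]_p%:E[F] <= H%:E <-> \int[mu]_x `|F x| `^ p <= (H `^ p)%:E.
Proof.
move=> p0 H0; rewrite -poweR_Lnorm ?gt_eqF// -poweR_EFin; split => FH.
  apply: gt0_ler_poweR => //; first exact: ltW.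
  - by rewrite in_itv/= Lnorm_ge0 leey.
  - by rewrite in_itv/= lee_fin H0 leey.
have E (y : \bar R) : 0 <= y -> y = (y `^ p) `^ p^-1.
  by move=> y0; rewrite -poweRrM mulfV ?gt_eqF// poweRe1.
rewrite (E _ (Lnorm_ge0 _ _ _)) (E H%:E) ?lee_fin//.
apply: gt0_ler_poweR => //; first by rewrite invr_ge0 ltW.
- by rewrite in_itv/= leey andbT poweR_ge0.
- by rewrite in_itv/= leey andbT lee_fin powR_ge0.
Qed.

End norm_conversions.

(** * Enumeration of the charged sets *)

(** The empty set pads the enumeration when A is finite. *)
Lemma countable_enumeration (X : Type) (A : set (set X)) :
  countable A -> ~ A set0 ->
  exists u : nat -> set X, [/\ forall m, A (u m) \/ u m = set0,
    forall i j, A (u i) -> u i = u j -> i = j &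
    forall S, A S -> exists m, u m = S].
Proof.
move=> /countable_injP[g ginj] A0.
pose u m := xget set0 [set S | A S /\ g S = m].
have uP m : (A (u m) /\ g (u m) = m) \/ u m = set0.
  by rewrite /u; case: xgetP => [S -> [AS gS]|_]; [left|right].
exists u; split.
- by move=> m; have [[]|] := uP m; [left|right].
- move=> i j Ai uij; have [[_ gi]|ui0] := uP i; last by rewrite ui0 in Ai.
  have [[_ gj]|uj0] := uP j; last by rewrite uij uj0 in Ai.
  by rewrite -gi -gj uij.
move=> S AS; exists (g S).
have [[AgS gE]|ugS0] := uP (g S).
  by apply: ginj; rewrite ?inE.
by have [] := @xgetI _ set0 [set S' | A S' /\ g S' = g S] S (conj AS erefl);
  rewrite -/(u (g S)) ugS0.
Qed.

Section charged_sets.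
Context {disp : measure_display} {T : measurableType disp} {R : realType}.
Variable mu : {measure set T -> \bar R}.
Variables (p : R) (f : T -> R).
Hypothesis p1 : (1 <= p)%R.
Hypothesis fL : f \in Lfun mu p%:E.

Let p0 : (0 < p)%R. Proof. exact: lt_le_trans p1. Qed.

Lemma Lfun_measurable : measurable_fun setT f.
Proof. by move: fL => /sub_Lfun_mfun; rewrite inE. Qed.

Lemma Lfun_Lnorm_lty : 'N[mu]_p%:E[EFin \o f] < +oo.
Proof. by move: fL => /sub_Lfun_finLfun; rewrite inE. Qed.

Let mabs : measurable_fun setT (fun x => `|(f x)%:E|).
Proof.
by apply: measurableT_comp => //; apply/measurable_EFinP; exact: Lfun_measurable.
Qed.

Let h x := `|(f x)%:E| `^ p.

Let h0 x : 0 <= h x. Proof. exact: poweR_ge0. Qed.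

Let mh : measurable_fun setT h.
Proof. exact: (measurableT_comp (measurable_poweR p)). Qed.

Let h_lty : \int[mu]_x h x < +oo.
Proof.
rewrite (_ : \int[mu]_x h x = 'N[mu]_p%:E[EFin \o f] `^ p); last first.
  by rewrite poweR_Lnorm// gt_eqF.
by apply: poweR_lty; exact: Lfun_Lnorm_lty.
Qed.

Lemma average_ge0 S : 0 <= average mu f S.
Proof.
rewrite /average mule_ge0 ?inve_ge0 ?measure_ge0//.
by apply: integral_ge0.
Qed.

(** Averages are finite because |f| <= 1 + |f|^p. *)
Lemma average_fin_num S : measurable S -> 0 < mu S < +oo ->
  average mu f S \is a fin_num.
Proof.
move=> mS /andP[S0 Soo].
have Sfin : mu S \is a fin_num by rewrite ge0_fin_numE// ltW.
have mhS : measurable_fun S h by exact: measurable_funTS.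
have maS : measurable_fun S (fun x => `|(f x)%:E|) by exact: measurable_funTS.
have : \int[mu]_(x in S) `|(f x)%:E| < +oo.
  apply: (@le_lt_trans _ _ (\int[mu]_(x in S) (1 + h x))).
    apply: ge0_le_integral => //; first exact: emeasurable_funD.
    move=> x _; rewrite /h abse_EFin poweR_EFin -EFinD lee_fin.
    have [f1|f1] := leP `|f x|%R 1%R; first by rewrite ler_wpDr ?powR_ge0.
    rewrite ler_wpDl// -[leLHS]powRr1// ler_powR// ltW//.
  rewrite ge0_integralD// integral_cst// mul1e lte_add_pinfty//.
  by apply: le_lt_trans h_lty; apply: ge0_subset_integral.
move=> Ioo; rewrite /average fin_numM//.
  by rewrite fin_numV// gt_eqF// (lt_trans _ S0)// ltNyr.
by rewrite ge0_fin_numE// integral_ge0.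
Qed.

Lemma average_neq0 S : measurable S -> average mu f S != 0 ->
  0 < \int[mu]_(x in S) h x.
Proof.
move=> mS; apply: contraNT; rewrite -leNgt => hS.
have {}hS : \int[mu]_(x in S) `|h x| = 0.
  under eq_integral do rewrite gee0_abs//.
  by apply/eqP; rewrite eq_le hS integral_ge0.
suff fS : \int[mu]_(x in S) `|(f x)%:E| = 0 by rewrite /average fS mule0.
have mhS : measurable_fun S h by exact: measurable_funTS.
have mfS : measurable_fun S (EFin \o f).
  by apply: measurable_funTS; apply/measurable_EFinP; exact: Lfun_measurable.
apply/(ae_eq_integral_abs mu mS mfS).
move/(ae_eq_integral_abs mu mS mhS) : hS.
apply: filterS => x hx Sx; have /poweR_eq0_eq0 := hx Sx.
by move=> /(_ (abse_ge0 _))/eqP; rewrite abse_eq0 => /eqP.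
Qed.

Variables (N : nat) (SS : 'I_N -> set (set T)).
Variables (gamma C : R) (d : nat).
Hypothesis gamma0 : (0 < gamma)%R.
Hypothesis fms : forall k, finite_martingale_sparse mu gamma d C (SS k).

Lemma charged_enumeration k : exists u : nat -> set T,
  [/\ forall m, SS k (u m) \/ u m = set0,
    forall i j, SS k (u i) -> u i = u j -> i = j &
    forall S, SS k S -> average mu f S != 0 -> exists m, u m = S].
Proof.
have [av _ _] := fms k.
have [|u [uA uinj usurj]] :=
  countable_enumeration (countable_charged gamma0 (fms k) mh h0 h_lty).
  by move=> [_]; rewrite integral_set0 ltxx.
exists u; split.
- by move=> m; have [[Sm _]|] := uA m; [left|right].
- move=> i j Si uij; apply: (uinj) (uij).
  have [//|ui0] := uA i.
  by have [_] := av _ Si; rewrite ui0 measure0 ltxx.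
- move=> S SSS Sneq0; apply: usurj; split => //.
  by apply: average_neq0 => //; have [] := av _ SSS.
Qed.

End charged_sets.

Section representation.
Context {disp : measure_display} {T : measurableType disp} {R : realType}.
Variable mu : {measure set T -> \bar R}.
Variables (p : R) (f : T -> R).
Hypothesis p1 : (1 <= p)%R.
Hypothesis fL : f \in Lfun mu p%:E.
Variables (N : nat) (SS : 'I_N -> set (set T)) (u : 'I_N -> nat -> set T).
Hypothesis N1 : (1 <= N)%N.
Hypothesis avSS : forall k, averageable mu (SS k).
Hypothesis uSS : forall k m, SS k (u k m) \/ u k m = set0.
Hypothesis uinj : forall k i j, SS k (u k i) -> u k i = u k j -> i = j.
Hypothesis usurj :
  forall k S, SS k S -> average mu f S != 0 -> exists m, u k m = S.

Definition coef k m : R := fine (average mu f (u k m)).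

Lemma coefE k m : average mu f (u k m) = (coef k m)%:E.
Proof.
rewrite /coef fineK//; have [Sm|->] := uSS k m.
  by have [? ?] := avSS Sm; exact: average_fin_num p1 fL _ _ _.
by rewrite /average integral_set0 mule0.
Qed.

Lemma coef_ge0 k m : (0 <= coef k m)%R.
Proof. by rewrite fine_ge0// average_ge0. Qed.

Lemma measurable_enum k m : measurable (u k m).
Proof. by have [Sm|->//] := uSS k m; have [] := avSS Sm. Qed.

Definition partial_sparse n x : R :=
  max_step_sum (fun k (j : 'I_n) => u k j) (fun k j => coef k j) x.

Definition partial_maximal n x : R :=
  (\big[Num.max/0]_(kj : 'I_N * 'I_n) (coef kj.1 kj.2 * \1_(u kj.1 kj.2) x))%R.

Let term_ge0 k m x : (0 <= coef k m * \1_(u k m) x :> R)%R.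
Proof. by rewrite mulr_ge0 ?coef_ge0. Qed.

Lemma measurable_partial_sparse n : measurable_fun setT (partial_sparse n).
Proof. by apply: measurable_max_step_sum => k j; exact: measurable_enum. Qed.

Lemma measurable_partial_maximal n : measurable_fun setT (partial_maximal n).
Proof.
rewrite /partial_maximal; under eq_fun do rewrite -big_enum/=.
apply: measurable_bigmaxr => kj; apply: measurable_funM => //.
exact/measurable_indic/measurable_enum.
Qed.

Lemma partial_sparse_ge0 n x : (0 <= partial_sparse n x)%R.
Proof. exact: bigmax_ge_id. Qed.

Lemma partial_maximal_ge0 n x : (0 <= partial_maximal n x)%R.
Proof. exact: bigmax_ge_id. Qed.

Lemma coef_le_partial_maximal n k (j : 'I_n) x :
  u k j x -> (coef k j <= partial_maximal n x)%R.
Proof.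
move=> ux; rewrite /partial_maximal.
apply: le_trans (le_bigmax _ _ (k, j)) => /=.
by rewrite indicE mem_set// mulr1.
Qed.

Let step_sumE k n x :
  (step_sum (fun j : 'I_n => u k j) (fun j => coef k j) x =
   \sum_(0 <= m < n) coef k m * \1_(u k m) x)%R.
Proof. by rewrite /step_sum big_mkord. Qed.

Lemma partial_sparse_nd x :
  {homo partial_sparse ^~ x : n m / (n <= m)%N >-> (n <= m)%R}.
Proof.
move=> n m nm; apply/bigmax_leP; split; first exact: bigmax_ge_id.
move=> k _; apply: le_trans (le_bigmax _ _ k).
rewrite !step_sumE (big_cat_nat (leq0n n) nm)//= lerDl.
by apply: sumr_ge0 => j _.
Qed.

Lemma partial_maximal_nd x :
  {homo partial_maximal ^~ x : n m / (n <= m)%N >-> (n <= m)%R}.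
Proof.
move=> n m nm; apply/bigmax_leP; split; first exact: bigmax_ge_id.
by move=> [k j] _; exact: le_trans (le_bigmax _ _ (k, widen_ord nm j)).
Qed.

Lemma sparse_op_series k x :
  sparse_op mu (SS k) f x = \sum_(m <oo) (coef k m * \1_(u k m) x)%:E.
Proof.
pose P m := `[< SS k (u k m) >].
pose a S := average mu f S * (\1_S x : R)%:E.
have a0 S : 0 <= a S by rewrite mule_ge0 ?average_ge0 ?lee_fin.
transitivity (\sum_(m <oo | P m) a (u k m)).
  rewrite -esum_pred_image//; last first.
    by move=> i j /set_mem/asboolP Si _; exact: uinj Si.
  rewrite /sparse_op esum_mkcond [RHS]esum_mkcond; apply: eq_esum => S _.
  case: ifPn => [/set_mem SSS|nS]; last first.
    rewrite ifF//; apply/negbTE; apply: contra nS => /set_mem[m /asboolP Sm <-].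
    exact: mem_set.
  have [S0|Sneq0] := eqVneq (average mu f S) 0.
    by rewrite /a S0 mul0e; case: ifP.
  have [m um] := usurj SSS Sneq0.
  by rewrite mem_set//; exists m => //; apply/asboolP; rewrite um.
rewrite eseries_mkcond; apply: eq_eseriesr => m _.
rewrite /P; case: asboolP => [Sm|nSm]; first by rewrite /a coefE.
by have [//|->] := uSS k m; rewrite indic0 mulr0.
Qed.

Lemma max_sparse_op_sup x :
  max_sparse_op mu SS f x = ereal_sup (range (fun n => (partial_sparse n x)%:E)).
Proof.
apply/eqP; rewrite eq_le; apply/andP; split.
  rewrite /max_sparse_op; apply/bigmax_leP; split; first exact: leNye.
  move=> k _; rewrite sparse_op_series; apply: lime_le.
    by apply: is_cvg_nneseries => m _ _; rewrite lee_fin.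
  apply: nearW => n; apply: le_ereal_sup_tmp; exists (partial_sparse n x)%:E.
    by exists n.
  rewrite sumEFin lee_fin -step_sumE.
  exact: (le_bigmax _ (fun k => step_sum _ (fun j : 'I_n => coef k j) x) k).
apply: ge_ereal_sup => _ [n _ <-]; rewrite /partial_sparse /max_step_sum.
have ser k : (step_sum (fun j : 'I_n => u k j) (fun j => coef k j) x)%:E <=
    max_sparse_op mu SS f x.
  rewrite /max_sparse_op.
  apply: le_trans (le_bigmax _ (fun k => sparse_op mu (SS k) f x) k).
  rewrite sparse_op_series step_sumE -sumEFin.
  by apply: nneseries_lim_ge => m _ _; rewrite lee_fin.
elim/big_ind : _ => [|a b aM bM|k _]; last exact: ser.
  apply: le_trans (ser (Ordinal N1)).
  by rewrite lee_fin; apply: step_sum_ge0 => j; exact: coef_ge0.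
by rewrite /Num.max; case: ifP.
Qed.

Lemma maximal_op_sup x :
  maximal_op mu (\bigcup_k SS k) f x =
  ereal_sup (range (fun n => (partial_maximal n x)%:E)).
Proof.
apply/eqP; rewrite eq_le; apply/andP; split.
  rewrite /maximal_op ge_max; apply/andP; split.
    apply: le_ereal_sup_tmp; exists (partial_maximal 0 x)%:E; first by exists 0%N.
    by rewrite lee_fin partial_maximal_ge0.
  apply: ge_ereal_sup => _ [S [k _ SSS] <-].
  have [S0|Sneq0] := eqVneq (average mu f S) 0.
    rewrite S0 mul0e; apply: le_ereal_sup_tmp.
    exists (partial_maximal 0 x)%:E; first by exists 0%N.
    by rewrite lee_fin partial_maximal_ge0.
  have [m <-] := usurj SSS Sneq0; apply: le_ereal_sup_tmp.
  exists (partial_maximal m.+1 x)%:E; first by exists m.+1.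
  rewrite coefE -EFinM lee_fin.
  exact: (le_bigmax _ (fun kj : 'I_N * 'I_m.+1 =>
    coef kj.1 kj.2 * \1_(u kj.1 kj.2) x)%R (k, ord_max)).
apply: ge_ereal_sup => _ [n _ <-]; rewrite /partial_maximal.
elim/big_ind : _ => [|a b aM bM|[k j] _ /=].
- by rewrite /maximal_op le_max lexx.
- by rewrite /Num.max; case: ifP.
rewrite /maximal_op le_max; apply/orP.
have [Sm|->] := uSS k j; last by left; rewrite indic0 mulr0.
right; apply: ereal_sup_ubound; exists (u k j); first by exists k.
by rewrite coefE EFinM.
Qed.

End representation.

(** * Splitting by martingale collection *)

Section level_split.
Context {disp : measure_display} {T : measurableType disp} {R : realType}.
Variable mu : {measure set T -> \bar R}.
Variables (N d : nat) (SS : 'I_N -> set (set T)) (u : 'I_N -> nat -> set T).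
Variables (lev : 'I_N -> set T -> nat) (co : 'I_N -> nat -> R).
Hypothesis uSS : forall k m, SS k (u k m) \/ u k m = set0.
Hypothesis levd : forall k S, SS k S -> (lev k S < d)%N.
Hypothesis co0 : forall k m, (0 <= co k m)%R.

Definition split_pick n (F : 'I_N -> set T -> set T) (kl : 'I_N * 'I_d)
    (j : 'I_n) : set T :=
  pick_level (SS kl.1) (lev kl.1) kl.2 (u kl.1 \o val) (F kl.1) j.

Definition split_coef n (kl : 'I_N * 'I_d) (j : 'I_n) : R :=
  (d.+1%:R * co kl.1 j)%R.

(** A sum over d levels is at most the largest of its terms scaled by d + 1;
    the successor keeps the scaling factor positive when d = 0. *)
Lemma max_step_sum_split n x :
  (max_step_sum (fun k (j : 'I_n) => u k j) (fun k j => co k j) x <=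
   max_step_sum (split_pick (fun=> id)) (@split_coef n) x)%R.
Proof.
set G' := max_step_sum (split_pick _) _ x.
have G'0 : (0 <= G')%R by exact: bigmax_ge_id.
apply/bigmax_leP; split => // k _.
have D0 : (0 < d.+1%:R :> R)%R by rewrite ltr0n.
apply: (@le_trans _ _ (\sum_(l < d) \sum_(j < n)
    co k j * \1_(split_pick (fun=> id) (k, l) j) x)%R).
  rewrite exchange_big/=; apply: ler_sum => j _.
  have t0 (l : 'I_d) :
      (0 <= co k j * \1_(split_pick (fun=> id) (k, l) j) x :> R)%R.
    by rewrite mulr_ge0.
  have [Sj|->] := uSS k j; last by rewrite indic0 mulr0 sumr_ge0.
  rewrite (bigD1 (Ordinal (levd Sj)))//=.
  rewrite {1}/split_pick /pick_level/= asboolT//.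
  by rewrite lerDl sumr_ge0.
apply: (@le_trans _ _ (\sum_(l < d) d.+1%:R^-1 * G')%R).
  apply: ler_sum => l _; rewrite ler_pdivlMl//.
  apply: le_trans (le_bigmax _ _ (k, l)).
  rewrite /step_sum mulr_sumr le_eqVlt; apply/orP; left; apply/eqP.
  by apply: eq_bigr => j _; rewrite /split_coef mulrA.
rewrite sumr_const card_ord -[leLHS]mulr_natl mulrA ler_piMl//.
by rewrite ler_pdivrMr// mul1r ler_nat.
Qed.

Lemma split_tower n (gamma C : R) (E B : 'I_N -> set T -> set T) :
  (forall k i j, SS k (u k i) -> u k i = u k j -> i = j) ->
  (forall k, tower_choice mu gamma C d (SS k) (E k) (B k) (lev k)) ->
  forall kl, sparse_tower mu gamma C (@split_pick n (fun=> id) kl)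
    (split_pick B kl) (split_pick E kl).
Proof.
move=> uinj tc [k l]; apply: (tower_choice_pick l (u := u k \o val) (tc k)).
by move=> i j /= Si uij; apply: ord_inj; exact: uinj Si uij.
Qed.

Lemma split_pick_sub n kl (j : 'I_n) x :
  split_pick (fun=> id) kl j x -> u kl.1 j x.
Proof. by rewrite /split_pick /pick_level; case: asboolP. Qed.

End level_split.

(** Operator norms are compared one function at a time: H stands for the bound
    A times the norm of f. *)
Lemma opnorm_le_scale {disp : measure_display} {T : measurableType disp}
    {R : realType} (mu : {measure set T -> \bar R}) (p K : R)
    (nrm : (T -> \bar R) -> \bar R) (U V : (T -> R) -> T -> \bar R) :
  (0 < K)%R ->
  (forall (f : T -> R) (H : R), f \in Lfun mu p%:E -> (0 <= H)%R ->
    nrm (V f) <= H%:E -> nrm (U f) <= (K * H)%:E) ->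
  opnorm mu p nrm U <= K%:E * opnorm mu p nrm V.
Proof.
move=> K0 UV; rewrite muleC -lee_pdivrMr//.
apply: le_ereal_inf_tmp => _ [A [A0 AV] <-].
rewrite lee_pdivrMr// -EFinM; apply: ereal_inf_lbound.
exists (A * K)%R => //; split; first by rewrite mulr_ge0// ltW.
move=> f fL; pose r := fine ('N[mu]_p%:E[EFin \o f]).
have rE : 'N[mu]_p%:E[EFin \o f] = r%:E.
  by rewrite fineK// ge0_fin_numE ?Lnorm_ge0//; exact: Lfun_Lnorm_lty.
have r0 : (0 <= r)%R by rewrite fine_ge0// Lnorm_ge0.
have := AV f fL; rewrite rE -!EFinM => Vf.
rewrite (_ : A * K * r = K * (A * r))%R; last by ring.
by apply: UV => //; rewrite mulr_ge0.
Qed.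

(** * Transfer to arbitrary families *)

Section transfer.
Context {R : realType}.

(** Reduction to finitely many sets: only countably many sets charge f, so both
    operators are increasing limits over finite subfamilies, and each of the N
    families splits into d families, each covered by one martingale. *)
Lemma finite_approximation {disp} {T : measurableType disp}
    (mu : {measure set T -> \bar R}) (gamma C C' : R) (d : nat) (p : R) (N : nat)
    (SS : 'I_N -> set (set T)) (f : T -> R) :
  (0 < gamma)%R -> (C <= C')%R -> (1 <= p)%R -> (1 <= N)%N ->
  (forall k, finite_martingale_sparse mu gamma d C (SS k)) ->
  f \in Lfun mu p%:E ->
  exists G V : nat -> T -> R,
  [/\ exhausts G (max_sparse_op mu SS f),
      exhausts V (maximal_op mu (\bigcup_k SS k) f) &
      forall n, exists (S B E : 'I_N * 'I_d -> 'I_n -> set T)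
                       (al : 'I_N * 'I_d -> 'I_n -> R),
      [/\ forall kl, sparse_tower mu gamma C' (S kl) (B kl) (E kl),
          forall kl j, (0 <= al kl j)%R,
          forall kl j x, S kl j x -> (al kl j <= d.+1%:R * V n x)%R &
          forall x, (G n x <= max_step_sum S al x)%R]].
Proof.
move=> g0 CC' p1 N1 fms fL.
have /choice[u uP] := charged_enumeration p1 fL g0 fms.
have /choice[w wP] : forall k, exists w : (set T -> set T) * (set T -> set T) *
    (set T -> nat), tower_choice mu gamma C' d (SS k) w.1.1 w.1.2 w.2.
  move=> k; have [E [B [lev EBlev]]] := tower_choice_exists CC' (fms k).
  by exists (E, B, lev).
have uSS k m : SS k (u k m) \/ u k m = set0 by case: (uP k).
have uinj k i j : SS k (u k i) -> u k i = u k j -> i = j.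
  by case: (uP k) => _ + _; exact.
have usurj k S : SS k S -> average mu f S != 0 -> exists m, u k m = S.
  by case: (uP k) => _ _; exact.
have av k := choice_averageable (wP k).
have levd k S : SS k S -> ((w k).2 S < d)%N by exact: (choice_lev (wP k)).
have co0 := coef_ge0 mu f u.
exists (partial_sparse mu f u), (partial_maximal mu f u); split.
- split; first exact: measurable_partial_sparse av uSS.
  + exact: partial_sparse_ge0.
  + exact: partial_sparse_nd.
  + by move=> x; exact: (max_sparse_op_sup p1 fL N1 av uSS uinj usurj x).
- split; first exact: measurable_partial_maximal av uSS.
  + exact: partial_maximal_ge0.
  + exact: partial_maximal_nd.
  + by move=> x; exact: (maximal_op_sup p1 fL av uSS usurj x).
move=> n; pose lev k := (w k).2.
exists (split_pick SS u lev (fun=> id)), (split_pick SS u lev (fun k => (w k).1.2)),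
  (split_pick SS u lev (fun k => (w k).1.1)), (@split_coef _ _ d (coef mu f u) n); split.
- by apply: split_tower.
- by move=> kl j; rewrite mulr_ge0.
- move=> kl j x /split_pick_sub ux; rewrite ler_wpM2l//.
  exact: coef_le_partial_maximal.
- by move=> x; exact: max_step_sum_split uSS levd co0 n x.
Qed.

Let succ_gt0 (d : nat) : (0 < d.+1%:R :> R)%R. Proof. by rewrite ltr0n. Qed.

Lemma max_sparse_op_weak (gamma C : R) (d : nat) (p : R) :
  (0 < gamma)%R -> (1 <= p)%R ->
  exists2 c : R, (0 < c)%R &
    forall (disp : measure_display) (T : measurableType disp)
      (mu : {measure set T -> \bar R}) (N : nat) (SS : 'I_N -> set (set T))
      (f : T -> R) (H : R),
    (1 <= N)%N ->
    (forall k, finite_martingale_sparse mu gamma d C (SS k)) ->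
    f \in Lfun mu p%:E -> (0 <= H)%R ->
    weak_Lnorm mu p (maximal_op mu (\bigcup_k SS k) f) <= H%:E ->
    weak_Lnorm mu p (max_sparse_op mu SS f) <= (c * log_plus R N * H)%:E.
Proof.
move=> g0 p1; have p0 : (0 < p)%R by exact: lt_le_trans p1.
pose C' : R := Num.max C 1%R.
have C'0 : (0 < C')%R by rewrite lt_max ltr01 orbT.
have CC' : (C <= C')%R by rewrite le_max lexx.
have [c c0 cP] := max_step_sum_weak d g0 C'0 p1.
pose D : R := d.+1%:R; have D0 : (0 < D)%R := succ_gt0 d.
exists (c * D)%R; first exact: mulr_gt0.
move=> disp T mu N SS f H N1 fms fL H0 MH.
have L0 : (0 <= log_plus R N)%R by rewrite (le_trans ler01)// log_plus_ge1.
have [G [V [exG exV fin]]] := finite_approximation g0 CC' p1 N1 fms fL.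
have V0 := exhausts_ge0 exV; have mV := exhausts_measurable exV.
apply/weak_Lnorm_leP => //.
  by rewrite !mulr_ge0// ltW.
move=> t t0; apply: (sup_superlevel_le exG) => n.
have [S [B [E [al [tower al0 alV GS]]]]] := fin n.
have mS kl j : measurable (S kl j) by case: (tower_measurable (tower kl) j).
apply: (@le_trans _ _ (mu [set x | t < max_step_sum S al x]%R)).
  apply: le_measure; rewrite ?inE.
  - by apply: measurable_superlevel; exact: exhausts_measurable exG n.
  - by apply: measurable_superlevel; exact: measurable_max_step_sum.
  - by move=> x /= /lt_le_trans; apply.
rewrite (_ : c * D * _ * H / t = c * log_plus R N * (D * H) / t)%R; last by ring.
apply: (cP _ _ _ _ _ _ _ B E _ (fun x => D * V n x)%R) => //.
- by rewrite card_prod !card_ord mulnC.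
- exact: measurable_funM.
- by move=> x; rewrite mulr_ge0// ltW.
- by rewrite mulr_ge0// ltW.
move=> s s0.
have -> : [set x | s < D * V n x]%R = [set x | s / D < V n x]%R.
  by apply/seteqP; split => x /=; rewrite ltr_pdivrMr// mulrC.
apply: (le_trans (superlevel_le_sup mu exV _ n)).
have := (weak_Lnorm_leP mu _ p0 H0).1 MH (s / D)%R (divr_gt0 s0 D0).
by move/le_trans; apply; rewrite lee_fin invf_div mulrA [(H * D)%R]mulrC.
Qed.

Lemma max_sparse_op_strong (gamma C : R) (d : nat) (p : R) :
  (0 < gamma)%R -> (1 <= p)%R ->
  exists2 c : R, (0 < c)%R &
    forall (disp : measure_display) (T : measurableType disp)
      (mu : {measure set T -> \bar R}) (N : nat) (SS : 'I_N -> set (set T))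
      (f : T -> R) (H : R),
    (1 <= N)%N ->
    (forall k, finite_martingale_sparse mu gamma d C (SS k)) ->
    f \in Lfun mu p%:E -> (0 <= H)%R ->
    'N[mu]_p%:E[maximal_op mu (\bigcup_k SS k) f] <= H%:E ->
    'N[mu]_p%:E[max_sparse_op mu SS f] <= (c * log_plus R N * H)%:E.
Proof.
move=> g0 p1; have p0 : (0 < p)%R by exact: lt_le_trans p1.
pose C' : R := Num.max C 1%R.
have C'0 : (0 < C')%R by rewrite lt_max ltr01 orbT.
have CC' : (C <= C')%R by rewrite le_max lexx.
have [c c0 cP] := max_step_sum_strong d g0 C'0 p1.
pose D : R := d.+1%:R; have D0 : (0 < D)%R := succ_gt0 d.
exists (c * D)%R; first exact: mulr_gt0.
move=> disp T mu N SS f H N1 fms fL H0 MH.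
have L0 : (0 <= log_plus R N)%R by rewrite (le_trans ler01)// log_plus_ge1.
have [G [V [exG exV fin]]] := finite_approximation g0 CC' p1 N1 fms fL.
have V0 := exhausts_ge0 exV; have mV := exhausts_measurable exV.
apply/Lnorm_leP => //.
  by rewrite !mulr_ge0// ltW.
apply: (sup_integral_powR_le exG) => // n.
have [S [B [E [al [tower al0 alV GS]]]]] := fin n.
have mS kl j : measurable (S kl j) by case: (tower_measurable (tower kl) j).
have mpow (g : T -> R) : measurable_fun setT g ->
    measurable_fun setT (fun x => (g x `^ p)%:E).
  by move=> mg; apply/measurable_EFinP; exact: (measurableT_comp (measurable_powR _)).
apply: (@le_trans _ _ (\int[mu]_x (max_step_sum S al x `^ p)%:E)).
  apply: ge0_le_integral => //.
  - by move=> x _; rewrite lee_fin powR_ge0.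
  - by apply: mpow; exact: exhausts_measurable exG n.
  - by apply: mpow; exact: measurable_max_step_sum.
  move=> x _; rewrite lee_fin; apply: ge0_ler_powR; rewrite ?nnegrE ?(ltW p0)//.
  - exact: exhausts_ge0 exG n x.
  - by apply: le_trans (GS x); exact: exhausts_ge0 exG n x.
apply: (@le_trans _ _ (((c * log_plus R N) `^ p)%:E *
    \int[mu]_x ((D * V n x) `^ p)%:E)).
  apply: (cP _ _ _ _ _ _ _ B E _ (fun x => D * V n x)%R) => //.
  - by rewrite card_prod !card_ord mulnC.
  - exact: measurable_funM.
  - by move=> x; rewrite mulr_ge0// ltW.
under eq_integral do rewrite powRM ?(ltW D0)// EFinM.
rewrite ge0_integralZl//; last 3 first.
- exact: mpow.
- by move=> x _; rewrite lee_fin powR_ge0.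
- by rewrite lee_fin powR_ge0.
apply: (@le_trans _ _ (((c * log_plus R N) `^ p)%:E *
    ((D `^ p)%:E * (H `^ p)%:E))).
  rewrite !lee_wpmul2l ?lee_fin ?powR_ge0//.
  apply: (le_trans (integral_powR_le_sup mu exV n p0)).
  exact: (Lnorm_leP mu _ p0 H0).1 MH.
rewrite -!EFinM lee_fin -!powRM ?mulr_ge0 ?(ltW c0) ?(ltW D0)//.
by rewrite (_ : c * log_plus R N * (D * H) = c * D * log_plus R N * H)%R//; ring.
Qed.
End transfer.

Theorem theorem2p4 (R : realType) (gamma : R) (d : nat) (C : R)
    (gamma01 : (0 < gamma < 1)%R) :
  (forall p : R, (1 <= p)%R ->
     exists2 c : R, (0 < c)%R &
       forall (disp : measure_display) (T : measurableType disp)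
         (mu : {measure set T -> \bar R}) (N : nat)
         (SS : 'I_N -> set (set T)),
         (1 <= N)%N ->
         (forall k, finite_martingale_sparse mu gamma d C (SS k)) ->
         weak_opnorm mu p (max_sparse_op mu SS) <=
           (c * log_plus R N)%:E *
           weak_opnorm mu p (maximal_op mu (\bigcup_k SS k))) /\
  (forall p : R, (1 < p)%R ->
     exists2 c : R, (0 < c)%R &
       forall (disp : measure_display) (T : measurableType disp)
         (mu : {measure set T -> \bar R}) (N : nat)
         (SS : 'I_N -> set (set T)),
         (1 <= N)%N ->
         (forall k, finite_martingale_sparse mu gamma d C (SS k)) ->
         strong_opnorm mu p (max_sparse_op mu SS) <=
           (c * log_plus R N `^ Num.max 1 (p - 1)^-1)%:E *
           strong_opnorm mu p (maximal_op mu (\bigcup_k SS k))).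
Proof.
have /andP[g0 _] := gamma01.
have L1 N : (1 <= log_plus R N)%R by exact: log_plus_ge1.
have L0 N : (0 < log_plus R N)%R by exact: lt_le_trans (L1 N).
split=> p p1.
  have [c c0 cP] := max_sparse_op_weak C d g0 p1; exists c => //.
  move=> disp T mu N SS N1 fms; apply: opnorm_le_scale; first exact: mulr_gt0.
  by move=> f H fL H0; exact: cP.
have [c c0 cP] := max_sparse_op_strong C d g0 (ltW p1); exists c => //.
move=> disp T mu N SS N1 fms.
apply: opnorm_le_scale; first by rewrite mulr_gt0// powR_gt0.
move=> f H fL H0 MH; apply: (le_trans (cP _ _ _ _ _ _ _ N1 fms fL H0 MH)).
rewrite lee_fin ler_wpM2r// ler_wpM2l ?(ltW c0)//.
(* Since log_+ N >= 1, an exponent at least 1 only enlarges the bound. *)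
rewrite -[leLHS]powRr1 ?(ltW (L0 N))//.
by rewrite ler_powR// le_max lexx.
Qed.
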